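(* Let $f\in\mathcal{U}$, let $y\in\mathcal{Y}_F$ be a minimizer of the atomistic total energy $\Phi^{total}(y)=\Phi(y)-\langle f,y\rangle$, and let $\underline{A}:=\min_\xi A_\xi(y)$. Assume that $\underline{A}>0$ and that $\min_\xi y'_\xi\ge\frac{r^*}{2}>0$. Let $\gamma$ be a blending function all of whose transitions between the atomistic and continuum models occur over regions containing $k$ atoms, let $\mathcal{I}$ be the interface, and let $\Phi^{total}_\gamma(y):=\Phi^{qce}_\gamma(y)-\langle f,y\rangle$, $\alpha_\xi:=\frac{\gamma_\xi+\gamma_{\xi-1}}{2}$, $\beta_\xi:=1-\frac{\gamma_{\xi+1}+\gamma_{\xi-1}}{2}$, and $\bar C_i:=C_i(2\min_\xi y'_\xi)$ for $i=1,\dots,4$. Let $C_1^\gamma$ and $C_2^\gamma$ be constants such that $$\varepsilon\|\Delta\beta_\xi\|_{\ell^2_\varepsilon}\le C_1^\gamma\varepsilon^{\frac32}k^{-\frac12},\qquad \varepsilon\|\Delta\beta_\xi\|_{\ell^\infty}\le C_1^\gamma\varepsilon k^{-1},$$ $$\|\Delta^2\alpha_\xi\|_{\ell^2_\varepsilon}\le C_2^\gamma\varepsilon^{\frac12}k^{-\frac32},\qquad \|\Delta^2\alpha_\xi\|_{\ell^\infty}\le C_2^\gamma k^{-2}.$$ There exist constants $\delta_1=\delta_1(\underline{A})>0$ and $\delta_2=\delta_2(\min_\xi y'_\xi,\underline{A},\bar C_1,\bar C_2,\bar C_3,\gamma)>0$, depending only on the indicated quantities, such that if $$2k^{-2}C_2^\gamma\bar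 C_2+2\varepsilon k^{-1}C_1^\gamma\bar C_3\|y''_\xi\|_{\ell^\infty(\mathcal{I})}+2\varepsilon^2\left\{\bar C_3\|(1-\beta_{\xi-1})y'''_\xi\|_{\ell^\infty}+\bar C_4\|(1-\beta_\xi)(y''_\xi)^2\|_{\ell^\infty}\right\}\le\delta_1$$ and $$k^{-\frac32}C_2^\gamma\bar C_1+\varepsilon k^{-\frac12}C_1^\gamma\bar C_2\|y''_\xi\|_{\ell^\infty(\mathcal{I})}+\varepsilon^{\frac32}\left\{\bar C_2\|(1-\beta_{\xi-1})y'''_\xi\|_{\ell^2_\varepsilon}+\bar C_3\|(1-\beta_\xi)(y''_\xi)^2\|_{\ell^2_\varepsilon}\right\}\le\delta_2,$$ then there exists a locally unique minimizer $y_\gamma\in\mathcal{Y}_F$ of $\Phi^{total}_\gamma$ which satisfies $$\|y-y_\gamma\|_{\mathcal{U}^{1,2}}\le\frac{4}{\underline{A}}\left[\varepsilon^{\frac12}k^{-\frac32}C_2^\gamma\bar C_1+\varepsilon^{\frac32}k^{-\frac12}C_1^\gamma\bar C_2\|y''_\xi\|_{\ell^\infty(\mathcal{I})}+\varepsilon^2\left\{\bar C_2\|(1-\beta_{\xi-1})y'''_\xi\|_{\ell^2_\varepsilon}+\bar C_3\|(1-\beta_\xi)(y''_\xi)^2\|_{\ell^2_\varepsilon}\right\}\right].$$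
   Context: Let $N\in\mathbb{N}$, $\varepsilon=1/N$ and $F\in(0,\infty)$. Let $\mathcal{U}$ be the space of $u:\mathbb{Z}\to\mathbb{R}$ with $u_{\xi+N}=u_\xi$ for all $\xi$ and $\sum_{\xi=1}^N u_\xi=0$, and let $\mathcal{Y}_F$ be the set of $y:\mathbb{Z}\to\mathbb{R}$ of the form $y_\xi=F\varepsilon\xi+u_\xi$ with $u\in\mathcal{U}$. Write $\langle f,v\rangle=\varepsilon\sum_{\xi=1}^N f_\xi v_\xi$. Differences: $\Delta v_\xi=v_\xi-v_{\xi-1}$, $\Delta^2v_\xi=v_{\xi+1}-2v_\xi+v_{\xi-1}$, $v'_\xi=\frac{v_\xi-v_{\xi-1}}{\varepsilon}$, $v''_\xi=\frac{v_{\xi+1}-2v_\xi+v_{\xi-1}}{\varepsilon^2}$, $v'''_\xi=\frac{v_{\xi+1}-3v_\xi+3v_{\xi-1}-v_{\xi-2}}{\varepsilon^3}$. For $N$-periodic $v$, $\|v\|_{\ell^\infty}=\max_{1\le\xi\le N}|v_\xi|$, $\|v\|_{\ell^\infty(\mathcal{I})}=\max_{\xi\in\mathcal{I}}|v_\xi|$, and $\|v\|_{\ell^2_\varepsilon}=(\varepsilon\sum_{\xi=1}^N|v_\xi|^2)^{1/2}$; and $\|u\|_{\mathcal{U}^{1,2}}=\|u'\|_{\ell^2_\varepsilon}$. Potential (fixed): $\phi\in C^4((0,\infty],\mathbb{R})$; there is $r^*>0$ with $\phi''(r)>0$ for $r\in(0,r^* )$ and $\phi''(r)<0$ for $r\in(r^*,\infty)$;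 $\phi$ and its derivatives decay at infinity. $C_i(r_0):=\sup_{r\ge r_0}|\phi^{(i)}(r)|$ for $i=1,\dots,4$. Energies (for $y\in\mathcal{Y}_F$ with $y'_\xi>0$ for all $\xi$). Atomistic energy: $$\Phi(y)=\varepsilon\sum_{\xi=1}^N\{\phi(y'_\xi)+\phi(y'_\xi+y'_{\xi+1})\}.$$ BQCE energy with $N$-periodic blending function $\gamma:\mathbb{Z}\to[0,1]$: $$\Phi^{qce}_\gamma(y)=\varepsilon\sum_{\xi=1}^N\Big\{\phi(y'_\xi)+\tfrac{\gamma_\xi}{2}\{\phi(2y'_\xi)+\phi(2y'_{\xi+1})\}+\tfrac{1-\gamma_\xi}{2}\{\phi(y'_{\xi-1}+y'_\xi)+\phi(y'_{\xi+1}+y'_{\xi+2})\}\Big\}.$$ $A_\xi(y):=\phi''(y'_\xi)+2\phi''(y'_\xi+y'_{\xi+1})+2\phi''(y'_{\xi-1}+y'_\xi)$. Interface: $\gamma=0$ in the atomistic region and $\gamma=1$ in the continuum region; the interface $\mathcal{I}$ is the union of the regions over which $\gamma$ passes from one value to the other, and, by the paper's convention, $\Delta\beta_\xi$ is supported in $\mathcal{I}$, i.e. $\Delta\beta_\xi=0$ for $\xi\notin\mathcal{I}$. The positive integer $k$ is the number of atoms in each transition region. A ''locally unique minimizer'' is a local minimizer (on $\mathcal{Y}_F$) that is the only local minimizer in some neighbourhood of itself. *)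

(* Defs.v *)
From HB Require Import structures.
From mathcomp Require Import all_boot all_order all_algebra.
From mathcomp Require Import all_classical all_reals all_analysis.
Set Implicit Arguments.
Unset Strict Implicit.
Unset Printing Implicit Defensive.
Import Order.TTheory GRing.Theory Num.Theory.
Import numFieldNormedType.Exports.

Local Open Scope classical_set_scope.
Local Open Scope ring_scope.

(** Lattice functions are total functions [int -> R].  Sums, maxima and minima
    over one period range over the sites 1, ..., N. *)

Definition eps {R : realType} (N : nat) : R := N%:R^-1.

Definition Nperiodic {R : realType} (N : nat) (v : int -> R) : Prop :=
  forall xi : int, v (xi + N%:Z) = v xi.

Definition inU {R : realType} (N : nat) (u : int -> R) : Prop :=
  Nperiodic N u /\ \sum_(1 <= xi < N.+1) u xi%:Z = 0.

Definition inY {R : realType} (N : nat) (F : R) (y : int -> R) : Prop :=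
  exists2 u : int -> R, inU N u &
    forall xi : int, y xi = F * eps N * xi%:~R + u xi.

Definition pairing {R : realType} (N : nat) (f v : int -> R) : R :=
  eps N * \sum_(1 <= xi < N.+1) f xi%:Z * v xi%:Z.

Definition Delta {R : realType} (v : int -> R) (xi : int) : R :=
  v xi - v (xi - 1).

Definition Delta2 {R : realType} (v : int -> R) (xi : int) : R :=
  v (xi + 1) - 2 * v xi + v (xi - 1).

Definition d1 {R : realType} (N : nat) (v : int -> R) (xi : int) : R :=
  (v xi - v (xi - 1)) / eps N.

Definition d2 {R : realType} (N : nat) (v : int -> R) (xi : int) : R :=
  (v (xi + 1) - 2 * v xi + v (xi - 1)) / eps N ^+ 2.

Definition d3 {R : realType} (N : nat) (v : int -> R) (xi : int) : R :=
  (v (xi + 1) - 3 * v xi + 3 * v (xi - 1) - v (xi - 2)) / eps N ^+ 3.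

(* The seed 0 is harmless: the entries are nonnegative. *)
Definition linfty {R : realType} (N : nat) (v : int -> R) : R :=
  \big[Num.max/0]_(1 <= xi < N.+1) `|v xi%:Z|.

(* For [N]-periodic [v] and [I] this is the maximum over all of [I]; it is 0
   when [I] is empty. *)
Definition linfty_on {R : realType} (N : nat) (I : pred int)
    (v : int -> R) : R :=
  \big[Num.max/0]_(1 <= xi < N.+1 | I xi%:Z) `|v xi%:Z|.

Definition l2 {R : realType} (N : nat) (v : int -> R) : R :=
  Num.sqrt (eps N * \sum_(1 <= xi < N.+1) `|v xi%:Z| ^+ 2).

Definition U12norm {R : realType} (N : nat) (u : int -> R) : R :=
  l2 N (d1 N u).

(* The seed [v 1] is itself an entry since [0 < N]. *)
Definition minper {R : realType} (N : nat) (v : int -> R) : R :=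
  \big[Num.min/v 1]_(1 <= xi < N.+1) v xi%:Z.

(** The potential is a total function on [R] of which only the values on
    ]0, +oo[ matter.  Regularity up to +oo and the decay of [phi] and of its
    derivatives are expressed by limits. *)
Definition is_potential {R : realType} (phi : R -> R) (rs : R) : Prop :=
  [/\ (forall (i : nat) (r : R), (i < 4)%N -> 0 < r ->
         derivable (derive1n i phi) r 1),
      (forall r : R, 0 < r -> {for r, continuous (derive1n 4 phi)}),
      (forall i : nat, (i <= 4)%N ->
         derive1n i phi x @[x --> +oo%R] --> (0 : R)) &
      [/\ 0 < rs,
          (forall r : R, 0 < r -> r < rs -> 0 < derive1n 2 phi r) &
          (forall r : R, rs < r -> derive1n 2 phi r < 0)]].

Definition Csup {R : realType} (phi : R -> R) (i : nat) (r0 : R) : R :=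
  sup [set `|derive1n i phi r| | r in [set r : R | r0 <= r]].

Definition Phi {R : realType} (N : nat) (phi : R -> R) (y : int -> R) : R :=
  eps N * \sum_(1 <= xi < N.+1)
    (phi (d1 N y xi%:Z) + phi (d1 N y xi%:Z + d1 N y (xi%:Z + 1))).

Definition Phi_qce {R : realType} (N : nat) (phi : R -> R)
    (gamma y : int -> R) : R :=
  eps N * \sum_(1 <= xi < N.+1)
    (phi (d1 N y xi%:Z)
     + gamma xi%:Z / 2 *
         (phi (2 * d1 N y xi%:Z) + phi (2 * d1 N y (xi%:Z + 1)))
     + (1 - gamma xi%:Z) / 2 *
         (phi (d1 N y (xi%:Z - 1) + d1 N y xi%:Z)
          + phi (d1 N y (xi%:Z + 1) + d1 N y (xi%:Z + 2)))).

Definition Phi_total {R : realType} (N : nat) (phi : R -> R)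
    (f y : int -> R) : R :=
  Phi N phi y - pairing N f y.

Definition Phi_qce_total {R : realType} (N : nat) (phi : R -> R)
    (gamma f y : int -> R) : R :=
  Phi_qce N phi gamma y - pairing N f y.

Definition Acoef {R : realType} (N : nat) (phi : R -> R) (y : int -> R)
    (xi : int) : R :=
  derive1n 2 phi (d1 N y xi)
  + 2 * derive1n 2 phi (d1 N y xi + d1 N y (xi + 1))
  + 2 * derive1n 2 phi (d1 N y (xi - 1) + d1 N y xi).

(** Deformations at which the energies are defined. *)
Definition admissible {R : realType} (N : nat) (F : R) (y : int -> R) : Prop :=
  inY N F y /\ forall xi : int, 0 < d1 N y xi.

(* The space of displacements is finite dimensional, so measuring
   neighbourhoods with the U^{1,2} norm is no restriction. *)
Definition local_minimizer {R : realType} (N : nat) (F : R)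
    (E : (int -> R) -> R) (y : int -> R) : Prop :=
  admissible N F y /\
  exists2 rho : R, 0 < rho &
    forall z : int -> R, admissible N F z ->
      U12norm N (fun xi => z xi - y xi) < rho -> E y <= E z.

Definition locally_unique_minimizer {R : realType} (N : nat) (F : R)
    (E : (int -> R) -> R) (y : int -> R) : Prop :=
  local_minimizer N F E y /\
  exists2 rho : R, 0 < rho &
    forall z : int -> R, local_minimizer N F E z ->
      U12norm N (fun xi => z xi - y xi) < rho -> z = y.

Definition blending {R : realType} (N : nat) (gamma : int -> R) : Prop :=
  Nperiodic N gamma /\ forall xi : int, 0 <= gamma xi <= 1.

Definition alpha {R : realType} (gamma : int -> R) (xi : int) : R :=
  (gamma xi + gamma (xi - 1)) / 2.

Definition beta {R : realType} (gamma : int -> R) (xi : int) : R :=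
  1 - (gamma (xi + 1) + gamma (xi - 1)) / 2.

(** [is_interface N k gamma I]: off [I] every site is atomistic ([gamma = 0])
    or continuum ([gamma = 1]), and [gamma] does not jump between neighbouring
    sites off [I]; every site of [I] lies in a transition region
    a, ..., a + k - 1 of exactly [k] sites of [I], between an atomistic site
    and a continuum site (in either order).  Transition regions are taken wide
    enough to contain the support of [Delta (beta gamma)], whose stencil
    reaches slightly beyond the sites where [gamma] varies. *)
Record is_interface {R : realType} (N k : nat) (gamma : int -> R)
    (I : pred int) : Prop := IsInterface {
  interface_periodic : forall xi : int, I (xi + N%:Z) = I xi ;
  interface_off : forall xi : int, ~~ I xi -> gamma xi = 0 \/ gamma xi = 1 ;
  interface_nojump : forall xi : int, ~~ I (xi - 1) -> ~~ I xi ->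
    gamma xi = gamma (xi - 1) ;
  interface_region : forall xi : int, I xi -> exists a : int,
    [/\ a <= xi < a + k%:Z,
        forall eta : int, a <= eta < a + k%:Z -> I eta,
        ~~ I (a - 1) /\ ~~ I (a + k%:Z) &
        (gamma (a - 1) = 0 /\ gamma (a + k%:Z) = 1) \/
        (gamma (a - 1) = 1 /\ gamma (a + k%:Z) = 0)] ;
  interface_supp : forall xi : int, ~~ I xi -> Delta (beta gamma) xi = 0 }.

(* Main.v *)
Require Import Defs.
From HB Require Import structures.
From mathcomp Require Import all_boot all_order all_algebra.
From mathcomp Require Import all_classical all_reals all_analysis.
From mathcomp Require Import ring lra zify.
Import Order.TTheory GRing.Theory Num.Theory.
Import numFieldNormedType.Exports.

Local Open Scope ring_scope.

(** Write [z] for the strain [d1 N y].  After resummation both energies have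
    the form
      [eps * \sum_i (phi (z i) + a i * phi (2 * z i)
                     + b i * phi (z i + z (i + 1)))],
    with [(a, b) = (0, 1)] for the atomistic model and
    [(a, b) = (alpha, beta)] for the blended one ([pair_energy]).

    Consistency.  The forces of the two models differ by [blend_defect] of
    [phi'], and the diagonal coefficients of their Hessians by twice the
    [blend_defect] of [phi''].  Expanding a function [g] about [2 * z i], the
    zeroth-order terms of its defect collapse to [- Delta2 alpha], because
    [2 * alpha i - (1 - beta i) - (1 - beta (i - 1)) = - Delta2 alpha i]; the
    first-order terms form a discrete product rule for [(1 - beta) * y''],
    that is one term with [Delta beta] and one with [y''']; what remains is
    quadratic in [y''] ([blend_defect_le]).  Maximum norms give the stability
    condition, Cauchy-Schwarz gives the residual.

    Stability.  Every next-nearest neighbour bond of [y] is at least [rs] long,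
    so [phi''] is nonpositive there and
    [(p + q) ^+ 2 <= 2 * p ^+ 2 + 2 * q ^+ 2] bounds the Hessian from below by a
    diagonal form.  For the atomistic model its coefficients are [Acoef]; the
    first smallness condition costs at most [Amin / 4] in passing to the
    blended model, and moving every strain by at most [eta] costs at most
    another [Amin / 4].  Hence the blended energy is strongly convex with
    modulus [Amin / 2] on the set of strains within [eta] of that of [y]
    ([pair_energy_strongly_convex]).

    Existence.  Since one summand is at most the whole sum, the
    [U^{1,2}]-ball of radius [sqrt eps * eta] about [y] lies in that set; it is
    compact, so the blended total energy has a minimizer on it
    ([ball_minimizer]).  As [y] is stationary for the atomistic energy, the
    derivative of the blended energy at [y] is just the residual, of dual norm
    at most [T], where [T] is the bracket in the error bound.  Comparing the
    energies of [y] and of the minimizer at distance [d] gives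
    [Amin / 4 * d ^+ 2 <= T * d], so [d <= 4 / Amin * T].  The second smallness
    condition makes this less than the radius: the minimizer is interior,
    hence a genuine local minimizer, and strong convexity excludes a second
    one in the ball ([nearby_minimizer]). *)

(** * Calculus of the potential *)

Lemma eq_ler (R : realType) (x y : R) : x = y -> x <= y.
Proof. by move=> ->. Qed.

(** Rolle applied to the remainder as a function of the base point, with the
    quadratic coefficient tuned so that it vanishes at both ends. *)
Lemma taylor2 (R : realType) (f f1 f2 : R -> R) (a b : R) :
  0 < a -> 0 < b ->
  (forall x : R, 0 < x -> is_derive x 1 f (f1 x)) ->
  (forall x : R, 0 < x -> is_derive x 1 f1 (f2 x)) ->
  exists c, Num.min a b <= c <= Num.max a b /\
    f b = f a + f1 a * (b - a) + f2 c / 2 * (b - a) ^+ 2.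
Proof.
move=> a0 b0 df df1.
have [->|ab] := eqVneq a b.
  by exists b; split; [rewrite minxx maxxx lexx | rewrite subrr; ring].
have ba : b - a != 0 by rewrite subr_eq0 eq_sym.
pose K := (f b - f a - f1 a * (b - a)) / (b - a) ^+ 2.
pose G x := f b - f x - f1 x * (b - x) - K * (b - x) ^+ 2.
have dG (x : R) : 0 < x -> is_derive x 1 G (- f2 x * (b - x) + 2 * K * (b - x)).
  move=> x0; have := df x x0; have := df1 x x0 => H1 H2.
  rewrite /G; apply: is_derive_eq; rewrite /GRing.scale /=; ring.
have Ga : G a = 0 by rewrite /G /K; field.
have Gb : G b = 0 by rewrite /G /K; ring.
have Gab : G (Num.min a b) = G (Num.max a b).
  by rewrite /Num.min /Num.max; case: ifP => _; rewrite Ga Gb.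
have mM : Num.min a b < Num.max a b.
  by rewrite gt_min lt_max !lt_max !ltxx /= orbF; case: ltgtP ab.
have m0 : 0 < Num.min a b by rewrite lt_min a0 b0.
have pos x : Num.min a b <= x -> 0 < x by exact: lt_le_trans.
have [x||c cI dc] := Rolle mM _ _ Gab.
- rewrite in_itv /= => /andP[+ _] => /ltW /pos x0.
  by have := dG x x0 => ?; exact: ex_derive.
- apply: derivable_within_continuous => x.
  rewrite in_itv /= => /andP[/pos x0 _].
  by have := dG x x0 => ?; exact: ex_derive.
move: cI; rewrite in_itv /= => /andP[mc cM].
exists c; split; first by rewrite !ltW.
have c0 := pos c (ltW mc).
have bc : b - c != 0.
  rewrite subr_eq0; apply/eqP => e; move: mc cM; rewrite -e.
  by rewrite gt_min lt_max !ltxx /= !orbF => /lt_trans h /h; rewrite ltxx.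
have e0 : - f2 c * (b - c) + 2 * K * (b - c) = 0.
  have := dG c c0 => h; rewrite -(@derive_val _ _ _ _ _ _ _ h).
  by rewrite (@derive_val _ _ _ _ _ _ _ dc).
have e1 : f2 c = 2 * K.
  apply: (mulIf bc); apply/eqP; rewrite -subr_eq0 -oppr_eq0 -e0; apply/eqP.
  by ring.
by rewrite e1 /K; field.
Qed.

Lemma potential_is_derive (R : realType) (phi : R -> R) (rs : R) (i : nat)
    (r : R) : is_potential phi rs -> (i < 4)%N -> 0 < r ->
  is_derive r 1 (derive1n i phi) (derive1n i.+1 phi r).
Proof.
move=> [dphi _ _ _] i4 r0; apply: DeriveDef; first exact: dphi.
by rewrite derive1nS derive1E.
Qed.

Lemma potential_continuous (R : realType) (phi : R -> R) (rs : R) (i : nat)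
    (r : R) : is_potential phi rs -> (i <= 4)%N -> 0 < r ->
  {for r, continuous (derive1n i phi)}.
Proof.
move=> hphi; rewrite leq_eqVlt => /orP[/eqP-> r0|i4 r0].
  by case: hphi => _ /(_ r r0).
have [dphi _ _ _] := hphi.
by apply/differentiable_continuous/derivable1_diffP/dphi.
Qed.

(** The supremum defining [Csup] is over a bounded set: the derivative is
    continuous on compact intervals and tends to 0 at infinity. *)
Lemma Csup_ge (R : realType) (phi : R -> R) (rs : R) (i : nat) (r0 r : R) :
  is_potential phi rs -> (i <= 4)%N -> 0 < r0 -> r0 <= r ->
  `|derive1n i phi r| <= Csup phi i r0.
Proof.
move=> hphi i4 r00 r0r.
have [_ _ /(_ i i4) lim0 _] := hphi.
have [X [_ HX]] : \forall x \near +oo%R, `|derive1n i phi x| < 1.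
  by have /cvgr0Pnorm_lt := lim0; apply.
pose Y := Num.max r0 (X + 1).
have cY : ({within `[r0, Y], continuous (fun x => `|derive1n i phi x|)})%classic.
  apply: continuous_in_subspaceT => x; rewrite inE /= in_itv /= => /andP[r0x _].
  apply: continuous_comp; last exact: norm_continuous.
  by apply: (@potential_continuous _ _ rs) => //; apply: lt_le_trans r0x.
have r0Y : r0 <= Y by rewrite le_max lexx.
have [c _ Hc] := EVT_max r0Y cY.
apply: (@ub_le_sup _ [set `|derive1n i phi r| | r in [set r : R | r0 <= r]]).
  exists (Num.max 1 `|derive1n i phi c|) => _ [x /= r0x <-].
  rewrite le_max; have [xY|Yx] := leP x Y.
    by apply/orP; right; apply: Hc; rewrite in_itv /= r0x xY.
  apply/orP; left; apply/ltW/HX; move: Yx; rewrite gt_max => /andP[_].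
  by apply: lt_trans; rewrite ltrDl.
by exists r.
Qed.

Lemma Csup_ge0 (R : realType) (phi : R -> R) (rs : R) (i : nat) (r0 : R) :
  is_potential phi rs -> (i <= 4)%N -> 0 < r0 -> 0 <= Csup phi i r0.
Proof.
move=> hphi i4 r00.
exact: (le_trans (normr_ge0 _) (@Csup_ge _ _ _ i r0 r0 hphi i4 r00 (lexx _))).
Qed.

(** The end point [rs] is reached by continuity from the right. *)
Lemma potential_concave (R : realType) (phi : R -> R) (rs r : R) :
  is_potential phi rs -> rs <= r -> derive1n 2 phi r <= 0.
Proof.
move=> hphi; have [_ _ _ [rs0 _ neg]] := hphi.
rewrite le_eqVlt => /orP[/eqP <-|/neg/ltW //].
have crs := @potential_continuous _ _ _ 2%N rs hphi isT rs0.
have /cvg_at_right_filter crs' :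
    (derive1n 2 phi x @[x --> rs] --> derive1n 2 phi rs)%classic by exact: crs.
apply: (cvgr_to_le crs' _).
near=> x; apply/ltW/neg; near: x; exact: nbhs_right_gt.
Unshelve. all: by end_near. Qed.

(** A Lipschitz bound on a whole half-line: thanks to the decay of the third
    derivative the constant depends only on the left end point.  This is why
    [delta2] can be chosen from the smallest strain alone. *)
Lemma potential_lipschitz (R : realType) (phi : R -> R) (rs r0 p q : R) :
  is_potential phi rs -> 0 < r0 -> r0 <= p -> r0 <= q ->
  `|derive1n 2 phi p - derive1n 2 phi q| <= Csup phi 3 r0 * `|p - q|.
Proof.
move=> hphi r00.
wlog pq : p q / p < q.
  move=> H hp hq; have [pq|qp|->] := ltgtP p q; first exact: H.
    by rewrite distrC (distrC p); exact: H.
  by rewrite !subrr normr0 mulr0.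
move=> hp hq; have pos x : r0 <= x -> 0 < x by exact: lt_le_trans.
have [x||c] := @MVT _ (derive1n 2 phi) (derive1n 3 phi) _ _ pq.
- rewrite in_itv /= => /andP[px _].
  apply: (potential_is_derive R phi rs 2 x hphi isT).
  by apply/pos/ltW/(le_lt_trans hp).
- apply: continuous_in_subspaceT => x; rewrite inE /= in_itv /= => /andP[px _].
  exact: (potential_continuous R phi rs 2 x hphi isT (pos x (le_trans hp px))).
rewrite in_itv /= => /andP[pc _] E.
rewrite distrC E (distrC p) normrM ler_wpM2r //.
by apply: (Csup_ge R phi rs 3) => //; apply: ltW; exact: le_lt_trans pc.
Qed.

(** * Averages and norms of periodic lattice functions *)

(** Both [pairing] and the square of [l2] unfold to instances of this scaled
    sum, so one set of rules serves them all. *)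
Definition avg {R : realType} (N : nat) (v : int -> R) : R :=
  eps N * \sum_(1 <= xi < N.+1) v xi%:Z.

Lemma eps_gt0 (R : realType) (N : nat) : (0 < N)%N -> 0 < eps N :> R.
Proof. by move=> N0; rewrite invr_gt0 ltr0n. Qed.

Lemma eq_avg (R : realType) (N : nat) (v w : int -> R) :
  (forall xi, v xi = w xi) -> avg N v = avg N w.
Proof. by move=> vw; congr (_ * _); apply: eq_bigr. Qed.

Lemma avgD (R : realType) (N : nat) (v w : int -> R) :
  avg N (fun xi => v xi + w xi) = avg N v + avg N w.
Proof. by rewrite /avg big_split mulrDr. Qed.

Lemma avgZ (R : realType) (N : nat) (c : R) (v : int -> R) :
  avg N (fun xi => c * v xi) = c * avg N v.
Proof. by rewrite /avg -mulr_sumr; ring. Qed.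

Lemma le_avg (R : realType) (N : nat) (v w : int -> R) :
  (forall xi, v xi <= w xi) -> avg N v <= avg N w.
Proof.
move=> vw; apply: ler_wpM2l; first by rewrite invr_ge0 ler0n.
by apply: ler_sum.
Qed.

Lemma avg_ge0 (R : realType) (N : nat) (v : int -> R) :
  (forall xi, 0 <= v xi) -> 0 <= avg N v.
Proof.
by move=> v0; rewrite mulr_ge0 ?invr_ge0 ?ler0n// sumr_ge0.
Qed.

Lemma periodicD (R : realType) (N : nat) (v : int -> R) (xi c : int) :
  Nperiodic N v -> v (xi + N%:Z + c) = v (xi + c).
Proof. by move=> hv; rewrite addrAC hv. Qed.

Lemma avg_succ (R : realType) (N : nat) (v : int -> R) :
  Nperiodic N v -> avg N (fun xi => v (xi + 1)) = avg N v.
Proof.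
move=> hv; congr (_ * _); case: N hv => [|n] hv; first by rewrite !big_geq.
rewrite big_nat_recr //= [in RHS]big_nat_recl //= addrC; congr (_ + _).
  by rewrite addrC hv.
apply: eq_bigr => i _; congr v.
by rewrite intS addrC.
Qed.

Lemma avg_pred (R : realType) (N : nat) (v : int -> R) :
  Nperiodic N v -> avg N (fun xi => v (xi - 1)) = avg N v.
Proof.
move=> hv; rewrite -(@avg_succ _ _ (fun xi => v (xi - 1))).
  by apply: eq_avg => xi; rewrite addrK.
by move=> xi; rewrite periodicD.
Qed.

Lemma periodicZ (R : realType) (N : nat) (v : int -> R) (xi q : int) :
  Nperiodic N v -> v (xi + q * N%:Z) = v xi.
Proof.
move=> hv; have per (n : nat) x : v (x + n%:Z * N%:Z) = v x.
  elim: n => [|n IH]; first by rewrite mul0r addr0.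
  by rewrite intS mulrDl mul1r addrA periodicD // IH.
case: q => n; first exact: per.
by rewrite NegzE mulNr -[in RHS](subrK (n.+1%:Z * N%:Z) xi) per.
Qed.

(** Norms and extrema range over the sites 1, ..., N only; this carries their
    bounds to all of [int]. *)
Lemma periodic_site (R : realType) (N : nat) (xi : int) : (0 < N)%N ->
  exists i : nat, (0 < i <= N)%N /\
    forall v : int -> R, Nperiodic N v -> v xi = v i%:Z.
Proof.
move=> N0; have N0' : N%:Z != 0 by rewrite eqz_nat -lt0n.
have r0 := modz_ge0 (xi - 1) N0'.
have rN := ltz_pmod (xi - 1) (_ : 0 < N%:Z); rewrite ltz_nat in rN.
exists (absz ((xi - 1) %% N)%Z).+1; split; first by move: r0 (rN N0); lia.
move=> v hv; rewrite intS gez0_abs //.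
rewrite {1}(_ : xi = 1 + ((xi - 1) %% N)%Z + ((xi - 1) %/ N)%Z * N%:Z); last first.
  by rewrite -addrA [X in 1 + X]addrC -divz_eq addrC subrK.
exact: periodicZ.
Qed.

Lemma linfty_ge (R : realType) (N : nat) (v : int -> R) (xi : int) :
  (0 < N)%N -> Nperiodic N v -> `|v xi| <= linfty N v.
Proof.
move=> N0 hv; have [i [/andP[i0 iN] H]] := periodic_site R N xi N0.
rewrite (H v hv); apply: (@bigmax_sup_seq _ _ _ _ _ i) => //.
by rewrite mem_index_iota ltnS i0.
Qed.

Lemma linfty_on_ge (R : realType) (N : nat) (I : pred int) (v : int -> R)
    (i : nat) : (0 < i <= N)%N -> I i -> `|v i| <= linfty_on N I v.
Proof.
move=> iN Ii; apply: (@bigmax_sup_seq _ _ _ _ _ i) => //.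
by rewrite mem_index_iota ltnS.
Qed.

Lemma linfty_on_ge0 (R : realType) (N : nat) (I : pred int) (v : int -> R) :
  0 <= linfty_on N I v.
Proof.
by rewrite /linfty_on; elim/big_ind: _ => // x y x0 y0; rewrite le_max x0.
Qed.

Lemma minper_le (R : realType) (N : nat) (v : int -> R) (xi : int) :
  (0 < N)%N -> Nperiodic N v -> minper N v <= v xi.
Proof.
move=> N0 hv; have [i [/andP[i0 iN] H]] := periodic_site R N xi N0.
rewrite (H v hv); apply: (@bigmin_inf_seq _ _ _ _ _ i) => //.
by rewrite mem_index_iota ltnS i0.
Qed.

Lemma l2_ge0 (R : realType) (N : nat) (v : int -> R) : 0 <= l2 N v.
Proof. exact: sqrtr_ge0. Qed.

Lemma sqr_l2 (R : realType) (N : nat) (v : int -> R) :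
  l2 N v ^+ 2 = avg N (fun xi => v xi ^+ 2).
Proof.
rewrite sqr_sqrtr; last exact: (@avg_ge0 _ _ (fun xi => `|v xi| ^+ 2)).
by apply: (eq_avg _ _ (fun xi => `|v xi| ^+ 2)) => xi; rewrite real_normK ?num_real.
Qed.

Lemma eq_l2 (R : realType) (N : nat) (v w : int -> R) :
  (forall xi, `|v xi| = `|w xi|) -> l2 N v = l2 N w.
Proof.
by move=> vw; congr Num.sqrt; congr (_ * _); apply: eq_bigr => i _; rewrite vw.
Qed.

(** Young's inequality with weight [s], optimized over [s]; when one of the
    norms vanishes the optimal weight is 0 or infinite and is replaced by a
    limiting argument. *)
Lemma avg_cauchy_schwarz (R : realType) (N : nat) (v w : int -> R) :
  avg N (fun xi => `|v xi| * `|w xi|) <= l2 N v * l2 N w.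
Proof.
have young (s : R) : 0 < s -> avg N (fun xi => `|v xi| * `|w xi|) <=
    (s * l2 N v ^+ 2 + s^-1 * l2 N w ^+ 2) / 2.
  move=> s0; rewrite !sqr_l2 -!avgZ -avgD mulrC -avgZ; apply: le_avg => xi /=.
  rewrite -[in leRHS](real_normK (num_real (v xi))).
  rewrite -[in leRHS](real_normK (num_real (w xi))).
  set a := `|v xi|; set b := `|w xi|.
  rewrite -subr_ge0 (_ : _ - _ = s^-1 / 2 * (s * a - b) ^+ 2); last first.
    by field; rewrite gt_eqF.
  by rewrite mulr_ge0 ?sqr_ge0 // divr_ge0 // invr_ge0 ltW.
have := l2_ge0 _ N v; rewrite le_eqVlt => /orP[/eqP v0|v0].
  rewrite -v0 mul0r; apply/ler_addgt0Pl => e e0; rewrite addr0.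
  have t0 : 0 < l2 N w ^+ 2 + 1 by rewrite ltr_wpDl ?sqr_ge0.
  have := young ((l2 N w ^+ 2 + 1) / e) (divr_gt0 t0 e0).
  move=> /le_trans; apply; rewrite -v0 expr0n /= mulr0 add0r invfM invrK.
  rewrite ler_pdivrMr // -mulrA ler_pdivrMl //; nra.
have := l2_ge0 _ N w; rewrite le_eqVlt => /orP[/eqP w0|w0]; last first.
  move: (young (l2 N w / l2 N v) (divr_gt0 w0 v0)) => /le_trans; apply.
  by rewrite le_eqVlt; apply/orP; left; apply/eqP; field; rewrite !gt_eqF.
rewrite -w0 mulr0; apply/ler_addgt0Pl => e e0; rewrite addr0.
have t0 : 0 < l2 N v ^+ 2 by rewrite exprn_gt0.
have := young (e / l2 N v ^+ 2) (divr_gt0 e0 t0).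
move=> /le_trans; apply; rewrite -w0 expr0n /= mulr0 addr0 divfK ?gt_eqF //.
by rewrite ler_pdivrMr //; nra.
Qed.

Lemma l2_triangle (R : realType) (N : nat) (v w : int -> R) :
  l2 N (fun xi => v xi + w xi) <= l2 N v + l2 N w.
Proof.
rewrite -[leRHS]ger0_norm ?addr_ge0 ?l2_ge0 //.
rewrite -ler_sqr ?nnegrE ?normr_ge0 ?l2_ge0 //.
rewrite real_normK ?num_real // sqrrD !sqr_l2.
have cs := avg_cauchy_schwarz _ N v w.
have : avg N (fun xi => (v xi + w xi) ^+ 2) <=
    avg N (fun xi => v xi ^+ 2) + 2 * avg N (fun xi => `|v xi| * `|w xi|)
    + avg N (fun xi => w xi ^+ 2).
  rewrite -avgZ -!avgD; apply: le_avg => xi.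
  rewrite -normrM; have := ler_norm (v xi * w xi); nra.
by move=> /le_trans; apply; rewrite lerD2r lerD2l mulr2n mulrDl mul1r lerD.
Qed.

Lemma l2_pred (R : realType) (N : nat) (v : int -> R) :
  Nperiodic N v -> l2 N (fun xi => v (xi - 1)) = l2 N v.
Proof.
move=> hv; apply/eqP; rewrite -(@eqrXn2 _ 2) ?l2_ge0 // !sqr_l2; apply/eqP.
by apply: (@avg_pred _ _ (fun xi => v xi ^+ 2)) => xi; rewrite hv.
Qed.

(** One summand never exceeds the whole sum, so passing from the averaged norm
    to a pointwise bound costs a factor [eps ^ (-1/2)].  This is the origin of
    that power of [eps] in the second smallness condition. *)
Lemma norm_le_of_l2 (R : realType) (N : nat) (v : int -> R) (eta : R)
    (xi : int) :
  (0 < N)%N -> Nperiodic N v -> 0 <= eta ->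
  l2 N v <= Num.sqrt (eps N) * eta -> `|v xi| <= eta.
Proof.
move=> N0 hv eta0 le_v; have e0 := eps_gt0 R N N0.
have [i [iN ->//]] := periodic_site R N xi N0.
rewrite -ler_sqr ?nnegrE ?normr_ge0 // -(ler_pM2l e0).
have : l2 N v ^+ 2 <= (Num.sqrt (eps N) * eta) ^+ 2.
  by rewrite ler_sqr ?nnegrE ?l2_ge0 // mulr_ge0 ?sqrtr_ge0.
rewrite exprMn (sqr_sqrtr (ltW e0)) => h; apply: le_trans h.
rewrite sqr_l2 ler_pM2l //.
rewrite (big_rem i) ?mem_index_iota ?ltnS //= real_normK ?num_real // lerDl.
by apply: sumr_ge0 => j _; exact: sqr_ge0.
Qed.

(** * Energies of pair type and their expansion *)

Lemma d1D (R : realType) (N : nat) (v w : int -> R) (xi : int) :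
  d1 N (fun i => v i + w i) xi = d1 N v xi + d1 N w xi.
Proof. by rewrite /d1; ring. Qed.

Lemma d1B (R : realType) (N : nat) (v w : int -> R) (xi : int) :
  d1 N (fun i => v i - w i) xi = d1 N v xi - d1 N w xi.
Proof. by rewrite /d1; ring. Qed.

Lemma d1Z (R : realType) (N : nat) (c : R) (v : int -> R) (xi : int) :
  d1 N (fun i => c * v i) xi = c * d1 N v xi.
Proof. by rewrite /d1; ring. Qed.

Lemma periodic_d1 (R : realType) (N : nat) (v : int -> R) :
  Nperiodic N v -> Nperiodic N (d1 N v).
Proof. by move=> hv xi; rewrite /d1 hv (periodicD _ _ _ _ _ hv). Qed.

Lemma sumE_avg (R : realType) (N : nat) (v : int -> R) : (0 < N)%N ->
  \sum_(1 <= xi < N.+1) v xi%:Z = 0 <-> avg N v = 0.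
Proof.
move=> N0; rewrite /avg; split=> [->|/eqP]; first by rewrite mulr0.
by rewrite mulf_eq0 gt_eqF ?eps_gt0 //= => /eqP.
Qed.

Lemma inU_lin (R : realType) (N : nat) (c : R) (u v : int -> R) :
  inU N u -> inU N v -> inU N (fun xi => u xi + c * v xi).
Proof.
move=> [pu su] [pv sv]; split; first by move=> xi; rewrite pu pv.
by rewrite big_split /= su -mulr_sumr sv mulr0 addr0.
Qed.

Lemma inY_addU (R : realType) (N : nat) (F : R) (y u : int -> R) :
  inY N F y -> inU N u -> inY N F (fun xi => y xi + u xi).
Proof.
move=> [u0 hu0 yE] hu; exists (fun xi => u0 xi + 1 * u xi); first exact: inU_lin.
by move=> xi; rewrite yE mul1r addrA.
Qed.

Lemma inY_subU (R : realType) (N : nat) (F : R) (y z : int -> R) :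
  inY N F y -> inY N F z -> inU N (fun xi => z xi - y xi).
Proof.
move=> [u hu yE] [v hv zE].
have -> : (fun xi => z xi - y xi) = (fun xi => v xi + (-1) * u xi).
  by apply: funext => xi; rewrite yE zE; ring.
exact: inU_lin.
Qed.

Lemma periodic_d1_inY (R : realType) (N : nat) (F : R) (y : int -> R) :
  inY N F y -> Nperiodic N (d1 N y).
Proof.
move=> [u [pu _] yE] xi; rewrite /d1 !yE pu (periodicD _ _ _ _ _ pu) -!yE !yE.
by congr (_ / _); rewrite !intrD; ring.
Qed.

Lemma pairing_lin (R : realType) (N : nat) (f y u : int -> R) (t : R) :
  pairing N f (fun xi => y xi + t * u xi) = pairing N f y + t * pairing N f u.
Proof.
have E v : pairing N f v = avg N (fun xi => f xi * v xi) by [].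
by rewrite !E -avgZ -avgD; apply: eq_avg => xi; ring.
Qed.

(** The energy of a strain field [z] in terms of two families of weights, [a]
    for the local and [b] for the nonlocal next-nearest neighbour bonds; it
    contains the atomistic and the blended energy. *)
Definition pair_energy {R : realType} (N : nat) (phi : R -> R)
    (a b z : int -> R) : R :=
  avg N (fun xi => phi (z xi) + a xi * phi (2 * z xi)
                   + b xi * phi (z xi + z (xi + 1))).

(** The derivative of [pair_energy] with respect to the strain at [xi], when
    [phi1] is the derivative of the potential. *)
Definition stress {R : realType} (phi1 : R -> R) (a b z : int -> R)
    (xi : int) : R :=
  phi1 (z xi) + 2 * a xi * phi1 (2 * z xi) + b xi * phi1 (z xi + z (xi + 1))
  + b (xi - 1) * phi1 (z (xi - 1) + z xi).

Lemma Phi_pair_energy (R : realType) (N : nat) (phi : R -> R) (y : int -> R) :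
  Phi N phi y = pair_energy N phi (fun=> 0) (fun=> 1) (d1 N y).
Proof.
rewrite /Phi.
by apply: (eq_avg _ _ (fun xi => phi (d1 N y xi) + phi (d1 N y xi + d1 N y (xi + 1))))
  => xi; ring.
Qed.

(** Collecting the contributions of each bond: [2 * z i] is weighted by the
    sites [i] and [i - 1], whence [alpha]; the bond from [i] to [i + 1] by the
    sites [i - 1] and [i + 1], whence [beta]. *)
Lemma Phi_qce_pair_energy (R : realType) (N : nat) (phi : R -> R)
    (gamma y : int -> R) : Nperiodic N gamma -> Nperiodic N (d1 N y) ->
  Phi_qce N phi gamma y
  = pair_energy N phi (alpha gamma) (beta gamma) (d1 N y).
Proof.
move=> hg; rewrite /Phi_qce; move: (d1 N y) => z hz.
have pg xi c := periodicD R N gamma xi c hg.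
have pz xi c := periodicD R N z xi c hz.
pose p1 (xi : int) : R := gamma (xi - 1) / 2 * phi (2 * z xi).
pose p2 (xi : int) : R := (1 - gamma (xi + 1)) / 2 * phi (z xi + z (xi + 1)).
pose p3 (xi : int) : R := (1 - gamma (xi - 1)) / 2 * phi (z xi + z (xi + 1)).
pose q (xi : int) : R := phi (z xi) + gamma xi / 2 * phi (2 * z xi).
have per1 : Nperiodic N p1 by move=> xi; rewrite /p1 ?hz ?pg ?pz.
have per2 : Nperiodic N p2 by move=> xi; rewrite /p2 ?hz ?pg ?pz.
have per3 : Nperiodic N p3 by move=> xi; rewrite /p3 ?hz ?pg ?pz.
transitivity (avg N (fun xi => q xi + p1 xi + p2 xi + p3 xi)); last first.
  apply: eq_avg => xi; rewrite /q /p1 /p2 /p3 /alpha /beta.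
  by field.
rewrite !avgD -(avg_succ _ _ p1) // -(avg_pred _ _ p2) // -(avg_succ _ _ p3) //.
rewrite -!avgD /avg; congr (_ * _); apply: eq_bigr => i _.
have e2 : i%:Z + 1 + 1 = i%:Z + 2 by rewrite -addrA.
by rewrite /q /p1 /p2 /p3 !addrK ?subrK e2; ring.
Qed.

(** Second-order Taylor expansion of each bond around the strain [z]; after
    shifting the index of the right-hand bond of each site the first-order
    terms collect into the stress.  The remainder is kept exact, so that it can
    be bounded from above (for stationarity) as well as from below (for
    convexity). *)
Lemma pair_energy_expansion (R : realType) (phi f1 f2 : R -> R) (N : nat)
    (a b z w : int -> R) :
  (forall r : R, 0 < r -> is_derive r 1 phi (f1 r)) ->
  (forall r : R, 0 < r -> is_derive r 1 f1 (f2 r)) -> Nperiodic N b ->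
  Nperiodic N z -> Nperiodic N w ->
  (forall xi, 0 < z xi) -> (forall xi, 0 < w xi) ->
  let between p q c := Num.min p q <= c <= Num.max p q in
  exists c0 c1 c2 : int -> R,
  [/\ forall xi, between (z xi) (w xi) (c0 xi),
      forall xi, between (2 * z xi) (2 * w xi) (c1 xi),
      forall xi, between (z xi + z (xi + 1)) (w xi + w (xi + 1)) (c2 xi) &
      pair_energy N phi a b w = pair_energy N phi a b z
        + avg N (fun xi => stress (f1) a b z xi * (w xi - z xi))
        + 2^-1 * avg N (fun xi =>
            f2 (c0 xi) * (w xi - z xi) ^+ 2
            + 4 * a xi * f2 (c1 xi) * (w xi - z xi) ^+ 2
            + b xi * f2 (c2 xi)
              * ((w xi - z xi) + (w (xi + 1) - z (xi + 1))) ^+ 2)].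
Proof.
move=> df df1 hb hz hw z0 w0 between.
have T (p q : R) : 0 < p -> 0 < q -> exists c, between p q c /\
    phi q = phi p + f1 p * (q - p) + f2 c / 2 * (q - p) ^+ 2.
  move=> p0 q0.
  exact: (taylor2 R phi f1 f2 p q p0 q0 df df1).
have [c0 H0] := choice (fun xi => T _ _ (z0 xi) (w0 xi)).
have [c1 H1] := choice (fun xi => T _ _ (mulr_gt0 (@ltr0n R 2) (z0 xi))
  (mulr_gt0 (@ltr0n R 2) (w0 xi))).
have [c2 H2] := choice (fun xi => T _ _ (addr_gt0 (z0 xi) (z0 (xi + 1)))
  (addr_gt0 (w0 xi) (w0 (xi + 1)))).
exists c0, c1, c2; split=> [xi|xi|xi|]; rewrite ?(H0 xi).1 ?(H1 xi).1 ?(H2 xi).1 //.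
pose s (xi : int) : R := b (xi - 1) * f1 (z (xi - 1) + z xi) * (w xi - z xi).
have pers : Nperiodic N s by move=> xi; rewrite /s hz hw !periodicD.
pose s' (xi : int) : R := (f1 (z xi) + 2 * a xi * f1 (2 * z xi)
  + b xi * f1 (z xi + z (xi + 1))) * (w xi - z xi).
rewrite (eq_avg _ _ (fun xi => stress _ _ _ _ _ * _)
  (fun xi => s' xi + s xi)); last first.
  by move=> xi; rewrite /stress /s /s'; ring.
rewrite avgD -(avg_succ _ _ _ pers) -avgD -avgZ -!avgD /pair_energy.
apply: eq_avg => xi; rewrite (H0 xi).2 (H1 xi).2 (H2 xi).2 /s /s' !addrK.
by ring.
Qed.

(** * Stationarity at local minimizers *)

Lemma l2Z (R : realType) (N : nat) (c : R) (v : int -> R) :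
  l2 N (fun xi => c * v xi) = `|c| * l2 N v.
Proof.
apply/eqP; rewrite -(@eqrXn2 _ 2) ?mulr_ge0 ?l2_ge0 // exprMn !sqr_l2.
rewrite real_normK ?num_real // -avgZ; apply/eqP; apply: eq_avg => xi.
by rewrite exprMn.
Qed.

Lemma minper_gt0 (R : realType) (N : nat) (v : int -> R) :
  (forall xi, 0 < v xi) -> 0 < minper N v.
Proof.
move=> v0; rewrite /minper; elim/big_ind: _ => // x y x0 y0.
by rewrite lt_min x0.
Qed.

(** Otherwise [t = - s * D] with a small [s > 0] makes the linear term dominate
    with the wrong sign. *)
Lemma linear_coef_eq0 (R : realType) (D Q tau : R) :
  0 < tau -> 0 <= Q ->
  (forall t, `|t| <= tau -> 0 <= t * D + t ^+ 2 * Q) -> D = 0.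
Proof.
move=> tau0 Q0 H; apply/eqP; apply/negPn/negP => D0.
have D2 : 0 < D ^+ 2 by rewrite exprn_even_gt0.
have nD : 0 < `|D| + 1 by rewrite ltr_wpDl.
have Q1 : 0 < Q + 1 by rewrite ltr_wpDl.
pose s := Num.min (tau / (`|D| + 1)) (Q + 1)^-1.
have s0 : 0 < s by rewrite lt_min divr_gt0 ?invr_gt0.
have sQ : s * (Q + 1) <= 1.
  by rewrite -ler_pdivlMr // div1r ge_min lexx orbT.
have sD : `|- s * D| <= tau.
  rewrite mulNr normrN normrM (gtr0_norm s0).
  apply: (@le_trans _ _ (s * (`|D| + 1))); first by rewrite ler_pM2l // lerDl.
  by rewrite -ler_pdivlMr // ge_min lexx.
have := H _ sD; rewrite (_ : _ + _ = s * D ^+ 2 * (s * Q - 1)); last by ring.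
rewrite (pmulr_rge0 _ (mulr_gt0 s0 D2)); lra.
Qed.

(** Along a line [w + t * u] the energy is at most
    [E w + t * D + t ^+ 2 * Q] for small [t], with [D] its derivative, which
    must therefore vanish. *)
Lemma stationarity (R : realType) (phi f1 f2 : R -> R) (N : nat) (F : R)
    (f a b : int -> R) (E : (int -> R) -> R) (w u : int -> R) :
  (forall r : R, 0 < r -> is_derive r 1 phi (f1 r)) ->
  (forall r : R, 0 < r -> is_derive r 1 f1 (f2 r)) ->
  (forall r0, 0 < r0 -> exists M, forall r, r0 <= r -> `|f2 r| <= M) ->
  (0 < N)%N -> Nperiodic N b ->
  (forall y, admissible N F y ->
     E y = pair_energy N phi a b (d1 N y) - pairing N f y) ->
  local_minimizer N F E w -> inU N u ->
  avg N (fun xi => stress f1 a b (d1 N w) xi * d1 N u xi) = pairing N f u.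
Proof.
move=> df df1 bnd N0 hb hE [[wY wpos] [rho rho0 wmin]] hu.
pose z := d1 N w; pose v := d1 N u.
have pz : Nperiodic N z by exact: periodic_d1_inY wY.
have pv : Nperiodic N v by apply: periodic_d1; case: hu.
pose zm := minper N z; have zm0 : 0 < zm by exact: minper_gt0.
have zmz xi : zm <= z xi by exact: minper_le.
pose V := linfty N v; have vV xi : `|v xi| <= V by exact: linfty_ge.
have V1 : 0 < V + 1.
  by rewrite ltr_wpDl //; apply: le_trans (vV 0); exact: normr_ge0.
have u1 : 0 < l2 N v + 1 by rewrite ltr_wpDl ?l2_ge0.
have [M HM] := bnd (zm / 2) (divr_gt0 zm0 (@ltr0n R 2)).
have M0 : 0 <= M by apply: le_trans (HM _ (lexx _)).
(* The first bound keeps the strains of [w + t * u] above [zm / 2], the second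
   keeps [w + t * u] in the neighbourhood where [w] is minimal. *)
pose tau := Num.min (zm / 2 / (V + 1)) (rho / 2 / (l2 N v + 1)).
pose Q := 2^-1 * avg N (fun xi => M * v xi ^+ 2 + 4 * `|a xi| * M * v xi ^+ 2
  + `|b xi| * M * (v xi + v (xi + 1)) ^+ 2).
have tau0 : 0 < tau by rewrite lt_min !divr_gt0.
have Q0 : 0 <= Q.
  rewrite mulr_ge0 //; apply: avg_ge0 => xi.
  by apply: addr_ge0; first apply: addr_ge0;
    apply: mulr_ge0; rewrite ?sqr_ge0 // !mulr_ge0.
apply/eqP; rewrite -subr_eq0; apply/eqP.
apply: (linear_coef_eq0 R _ Q tau) => // t; rewrite le_min => /andP[tV tu].
have zt xi : zm / 2 <= z xi + t * v xi.
  have : `|t * v xi| <= zm / 2.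
    rewrite ler_pdivlMr // in tV; apply: le_trans tV.
    rewrite normrM ler_wpM2l //; have := vV xi; lra.
  by rewrite ler_norml => /andP[+ _]; have := zmz xi; lra.
pose wt := fun xi => w xi + t * u xi.
have d1wt : d1 N wt = fun xi => z xi + t * v xi.
  by apply: funext => xi; rewrite d1D d1Z.
have zm2 : 0 < zm / 2 by rewrite divr_gt0.
have wtA : admissible N F wt.
  split; last by move=> xi; rewrite d1wt; apply: lt_le_trans (zt xi).
  apply: inY_addU => //; have [pu su] := hu.
  split; first by move=> xi; rewrite pu.
  by rewrite -mulr_sumr su mulr0.
have le_wt : E w <= E wt.
  apply: wmin => //; rewrite /U12norm.
  rewrite (eq_l2 _ _ _ (fun xi => t * v xi)); last first.
    by move=> xi; rewrite d1B d1wt /= addrAC subrr add0r.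
  rewrite l2Z; rewrite ler_pdivlMr // in tu.
  have := l2_ge0 _ N v; have := normr_ge0 t; nra.
have pzt : Nperiodic N (fun xi => z xi + t * v xi) by move=> xi; rewrite pz pv.
have zpos xi : 0 < z xi by exact: lt_le_trans (zmz xi).
have ztpos xi : 0 < z xi + t * v xi by exact: lt_le_trans (zt xi).
have [c0 [c1 [c2 [Hc0 Hc1 Hc2 Ew]]]] :=
  pair_energy_expansion R phi f1 f2 N a b z _ df df1 hb pz pzt zpos ztpos.
move: le_wt; rewrite !hE // d1wt Ew pairing_lin.
have -> : avg N (fun xi => stress f1 a b z xi * (z xi + t * v xi - z xi))
    = t * avg N (fun xi => stress f1 a b z xi * v xi).
  by rewrite -avgZ; apply: eq_avg => xi; ring.
set S2 := avg N (fun xi => _ + _ + _); set L := avg _ _.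
have SQ : 2^-1 * S2 <= t ^+ 2 * Q.
  rewrite [leRHS]mulrCA ler_pM2l // -avgZ; apply: le_avg => xi.
  have HM' (r : R) : zm / 2 <= r -> f2 r <= M.
    by move=> /HM; apply: le_trans; exact: ler_norm.
  have := zmz xi; have := zmz (xi + 1); have := zt xi; have := zt (xi + 1).
  move: (Hc0 xi) (Hc1 xi) (Hc2 xi); rewrite !ge_min.
  move=> /andP[h0 _] /andP[h1 _] /andP[h2 _] k1 k2 k3 k4.
  have m0 : `|f2 (c0 xi)| <= M by apply: HM; case/orP: h0; lra.
  have m1 : `|f2 (c1 xi)| <= M by apply: HM; case/orP: h1; lra.
  have m2 : `|f2 (c2 xi)| <= M by apply: HM; case/orP: h2; lra.
  have prod (p q s : R) : `|q| <= M -> p * q * s ^+ 2 <= `|p| * M * s ^+ 2.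
    move=> hq; apply: ler_wpM2r; first exact: sqr_ge0.
    apply: le_trans (ler_norm _) _; rewrite normrM.
    by rewrite ler_wpM2l.
  rewrite !mulrDr; apply: lerD; first apply: lerD.
  - have := prod 1 _ (t * v xi) m0; rewrite normr1 !mul1r.
    rewrite (_ : z xi + _ - z xi = t * v xi); last by ring.
    by move=> h; apply: le_trans h (eq_ler _ _ _ _); ring.
  - have := prod (4 * a xi) _ (t * v xi) m1; rewrite normrM ger0_norm //.
    rewrite (_ : z xi + _ - z xi = t * v xi); last by ring.
    by move=> h; apply: le_trans h (eq_ler _ _ _ _); ring.
  - have := prod (b xi) _ (t * (v xi + v (xi + 1))) m2.
    rewrite (_ : _ - z xi + _ = t * (v xi + v (xi + 1))); last by ring.
    by move=> h; apply: le_trans h (eq_ler _ _ _ _); ring.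
rewrite mulrBr; lra.
Qed.

(** * Consistency of the blended model *)

(** With [g] the derivative of the potential this is the difference of the
    blended and the atomistic stress; with [g] the second derivative, half the
    difference of the coefficients in the diagonal bound on the Hessian. *)
Definition blend_defect {R : realType} (g : R -> R) (gamma z : int -> R)
    (xi : int) : R :=
  2 * alpha gamma xi * g (2 * z xi)
  - (1 - beta gamma xi) * g (z xi + z (xi + 1))
  - (1 - beta gamma (xi - 1)) * g (z (xi - 1) + z xi).

Definition blend_d3 {R : realType} (N : nat) (gamma y : int -> R)
    (xi : int) : R :=
  (1 - beta gamma (xi - 1)) * d3 N y xi.

Definition blend_d2sq {R : realType} (N : nat) (gamma y : int -> R)
    (xi : int) : R :=
  (1 - beta gamma xi) * d2 N y xi ^+ 2.

Lemma d1_succ (R : realType) (N : nat) (y : int -> R) (xi : int) :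
  (0 < N)%N -> d1 N y (xi + 1) = d1 N y xi + eps N * d2 N y xi.
Proof.
move=> N0; have e0 := eps_gt0 R N N0; rewrite /d1 /d2 addrK.
by field; rewrite gt_eqF.
Qed.

Lemma d3E (R : realType) (N : nat) (y : int -> R) (xi : int) :
  (0 < N)%N -> eps N * d3 N y xi = d2 N y xi - d2 N y (xi - 1).
Proof.
move=> N0; have e0 := eps_gt0 R N N0; rewrite /d3 /d2 subrK -(addrA xi (-1)).
by rewrite -opprD; field; rewrite gt_eqF.
Qed.

(** The two next-nearest neighbour bonds of a site carry together the weight
    [alpha (xi + 1) + alpha (xi - 1)], which almost balances
    [2 * alpha xi]. *)
Lemma Delta2_alphaE (R : realType) (gamma : int -> R) (xi : int) :
  Delta2 (alpha gamma) xi
  = 1 - beta gamma xi + (1 - beta gamma (xi - 1)) - 2 * alpha gamma xi.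
Proof. by rewrite /Delta2 /alpha /beta !addrK ?subrK; field. Qed.

Lemma periodic_alpha (R : realType) (N : nat) (gamma : int -> R) :
  Nperiodic N gamma -> Nperiodic N (alpha gamma).
Proof. by move=> hg xi; rewrite /alpha hg (periodicD _ _ _ _ _ hg). Qed.

Lemma periodic_beta (R : realType) (N : nat) (gamma : int -> R) :
  Nperiodic N gamma -> Nperiodic N (beta gamma).
Proof. by move=> hg xi; rewrite /beta !(periodicD _ _ _ _ _ hg). Qed.

Lemma alpha_in01 (R : realType) (N : nat) (gamma : int -> R) (xi : int) :
  blending N gamma -> 0 <= alpha gamma xi <= 1.
Proof.
move=> [_ g01]; rewrite /alpha.
by have := g01 xi; have := g01 (xi - 1); lra.
Qed.

Lemma beta_in01 (R : realType) (N : nat) (gamma : int -> R) (xi : int) :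
  blending N gamma -> 0 <= beta gamma xi <= 1.
Proof.
move=> [_ g01]; rewrite /beta.
by have := g01 (xi + 1); have := g01 (xi - 1); lra.
Qed.

(** Taylor expansion of [g] about [2 * z xi]: the increments of the two
    neighbouring bonds are [eps * y'' xi] and [- eps * y'' (xi - 1)], so the
    first-order terms are a difference of [(1 - beta) * y''], which the product
    rule splits. *)
Lemma blend_defect_le (R : realType) (g g1 g2 : R -> R) (N : nat)
    (gamma y : int -> R) (m G0 G1 G2 : R) (xi : int) :
  (forall r : R, 0 < r -> is_derive r 1 g (g1 r)) ->
  (forall r : R, 0 < r -> is_derive r 1 g1 (g2 r)) ->
  (0 < N)%N -> 0 < m -> (forall i, m <= d1 N y i) ->
  (forall r, 2 * m <= r -> `|g r| <= G0) ->
  (forall r, 2 * m <= r -> `|g1 r| <= G1) ->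
  (forall r, 2 * m <= r -> `|g2 r| <= G2) ->
  `|blend_defect g gamma (d1 N y) xi|
  <= G0 * `|Delta2 (alpha gamma) xi|
     + eps N * G1 * (`|Delta (beta gamma) xi| * `|d2 N y xi|)
     + eps N ^+ 2 * (G1 * `|blend_d3 N gamma y xi|
       + G2 / 2 * (`|blend_d2sq N gamma y xi|
                   + `|blend_d2sq N gamma y (xi - 1)|)).
Proof.
move=> dg dg1 N0 m0 my b0 b1 b2.
set w3 := blend_d3 N gamma y; set w2 := blend_d2sq N gamma y.
have e0 := eps_gt0 R N N0.
have := my (xi - 1); have := my xi; have := my (xi + 1).
have zp := d1_succ R N y (xi - 1) N0; rewrite subrK in zp.
rewrite /blend_defect d1_succ //.
rewrite (_ : d1 N y (xi - 1) = d1 N y xi - eps N * d2 N y (xi - 1)); last first.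
  by rewrite zp addrK.
set p := d1 N y xi; set Y := d2 N y xi; set Y' := d2 N y (xi - 1).
move=> mp mxi mm.
have [||c [/andP[mc _] Ec]] := taylor2 R g g1 g2 (2 * p)
  (p + (p + eps N * Y)) _ _ dg dg1; [lra|lra|].
have [||c' [/andP[mc' _] Ec']] := taylor2 R g g1 g2 (2 * p)
  (p - eps N * Y' + p) _ _ dg dg1; [lra|lra|].
have hc : `|g2 c| <= G2 by apply: b2; move: mc; rewrite ge_min => /orP[]; lra.
have hc' : `|g2 c'| <= G2.
  by apply: b2; move: mc'; rewrite ge_min => /orP[]; lra.
have hg : `|g (2 * p)| <= G0 by apply: b0; lra.
have hg1 : `|g1 (2 * p)| <= G1 by apply: b1; lra.
have Ew3 : w3 xi = (1 - beta gamma (xi - 1)) * d3 N y xi by [].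
have Ed3 := d3E R N y xi N0.
rewrite Ec Ec' (_ : _ - _ - _ =
  - (g (2 * p) * Delta2 (alpha gamma) xi)
  + eps N * (g1 (2 * p) * (Delta (beta gamma) xi * Y))
  - eps N ^+ 2 * (g1 (2 * p) * w3 xi
                  + (g2 c / 2 * w2 xi + g2 c' / 2 * w2 (xi - 1)))); last first.
  rewrite Delta2_alphaE /Delta Ew3 /w2 /blend_d2sq -/Y -/Y'.
  rewrite (_ : eps N ^+ 2 * (g1 (2 * p) * _ + _) =
    eps N * g1 (2 * p) * (1 - beta gamma (xi - 1)) * (Y - Y')
    + eps N ^+ 2 * (g2 c / 2 * ((1 - beta gamma xi) * Y ^+ 2) +
      g2 c' / 2 * ((1 - beta gamma (xi - 1)) * Y' ^+ 2))); first by field.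
  by rewrite -Ed3; ring.
have nM (s t u : R) : `|s| <= u -> `|s * t| <= u * `|t|.
  by move=> su; rewrite normrM ler_wpM2r.
have e1 := ltW e0.
apply: le_trans (ler_normB _ _) _; apply: lerD.
  apply: le_trans (ler_normD _ _) _; rewrite normrN.
  apply: lerD; first exact: nM.
  by rewrite normrM (ger0_norm e1) -mulrA -normrM ler_wpM2l // nM.
rewrite normrM (ger0_norm (exprn_ge0 _ e1)) ler_wpM2l ?exprn_ge0 //.
apply: le_trans (ler_normD _ _) _; apply: lerD; first exact: nM.
apply: le_trans (ler_normD _ _) _; rewrite mulrDr.
by apply: lerD; apply: nM;
  rewrite normrM (ger0_norm (_ : 0 <= 2^-1)) // ler_wpM2r.
Qed.

(** Only the values of [v] on the interface matter, because [Delta beta] is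
    supported there. *)
Lemma periodic_interface_bound (R : realType) (N k : nat) (gamma : int -> R)
    (I : pred int) (v : int -> R) (xi : int) :
  (0 < N)%N -> is_interface N k gamma I -> Nperiodic N gamma ->
  Nperiodic N v ->
  `|Delta (beta gamma) xi| * `|v xi|
  <= linfty_on N I v * `|Delta (beta gamma) xi|.
Proof.
move=> N0 hI hg hv; rewrite mulrC -subr_ge0 -mulrBl.
have [i [iN E]] := periodic_site R N xi N0.
have hb := periodic_beta R N gamma hg.
have := E (fun j => (linfty_on N I v - `|v j|) * `|Delta (beta gamma) j|).
move=> -> => [|j]; last first.
  by rewrite hv /Delta periodicD // hb.
have [Ii|/(interface_supp hI) ->] := boolP (I i); last by rewrite normr0 mulr0.
by rewrite mulr_ge0 // subr_ge0 linfty_on_ge.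
Qed.

Lemma periodic_d2_inY (R : realType) (N : nat) (F : R) (y : int -> R) :
  (0 < N)%N -> inY N F y -> Nperiodic N (d2 N y).
Proof.
move=> N0 yY xi; have pd := periodic_d1_inY _ _ _ _ yY.
have E x : eps N * d2 N y x = d1 N y (x + 1) - d1 N y x.
  by rewrite d1_succ // addrC addKr.
by apply: (mulfI (lt0r_neq0 (eps_gt0 R N N0)));
  rewrite !E pd (periodicD _ _ _ _ _ pd).
Qed.

Lemma periodic_d3_inY (R : realType) (N : nat) (F : R) (y : int -> R) :
  (0 < N)%N -> inY N F y -> Nperiodic N (d3 N y).
Proof.
move=> N0 yY xi; have pd := periodic_d2_inY _ _ _ _ N0 yY.
by apply: (mulfI (lt0r_neq0 (eps_gt0 R N N0)));
  rewrite !d3E // pd (periodicD _ _ _ _ _ pd).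
Qed.

Lemma periodic_blend_d2sq (R : realType) (N : nat) (F : R)
    (gamma y : int -> R) :
  (0 < N)%N -> Nperiodic N gamma -> inY N F y ->
  Nperiodic N (blend_d2sq N gamma y).
Proof.
move=> N0 hg yY xi; rewrite /blend_d2sq (periodic_beta _ _ _ hg).
by rewrite (periodic_d2_inY _ _ _ _ N0 yY).
Qed.

Lemma periodic_blend_d3 (R : realType) (N : nat) (F : R) (gamma y : int -> R) :
  (0 < N)%N -> Nperiodic N gamma -> inY N F y ->
  Nperiodic N (blend_d3 N gamma y).
Proof.
move=> N0 hg yY xi.
rewrite /blend_d3 (periodicD _ _ _ _ _ (periodic_beta _ _ _ hg)).
by rewrite (periodic_d3_inY _ _ _ _ N0 yY).
Qed.

Lemma periodic_Delta (R : realType) (N : nat) (v : int -> R) :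
  Nperiodic N v -> Nperiodic N (Delta v).
Proof. by move=> hv xi; rewrite /Delta hv (periodicD _ _ _ _ _ hv). Qed.

Lemma periodic_Delta2 (R : realType) (N : nat) (v : int -> R) :
  Nperiodic N v -> Nperiodic N (Delta2 v).
Proof. by move=> hv xi; rewrite /Delta2 hv !(periodicD _ _ _ _ _ hv). Qed.

Lemma blend_defect_interface_le (R : realType) (g g1 g2 : R -> R) (N k : nat)
    (F : R) (gamma y : int -> R) (I : pred int) (m G0 G1 G2 : R) (xi : int) :
  (forall r : R, 0 < r -> is_derive r 1 g (g1 r)) ->
  (forall r : R, 0 < r -> is_derive r 1 g1 (g2 r)) ->
  (0 < N)%N -> 0 < m -> inY N F y -> (forall i, m <= d1 N y i) ->
  (forall r, 2 * m <= r -> `|g r| <= G0) ->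
  (forall r, 2 * m <= r -> `|g1 r| <= G1) ->
  (forall r, 2 * m <= r -> `|g2 r| <= G2) ->
  Nperiodic N gamma -> is_interface N k gamma I ->
  `|blend_defect g gamma (d1 N y) xi|
  <= G0 * `|Delta2 (alpha gamma) xi|
     + eps N * G1 * linfty_on N I (d2 N y) * `|Delta (beta gamma) xi|
     + eps N ^+ 2 * (G1 * `|blend_d3 N gamma y xi|
       + G2 / 2 * (`|blend_d2sq N gamma y xi|
                   + `|blend_d2sq N gamma y (xi - 1)|)).
Proof.
move=> dg dg1 N0 m0 yY my b0 b1 b2 hg hI.
have := blend_defect_le R g g1 g2 N gamma y m G0 G1 G2 xi
  dg dg1 N0 m0 my b0 b1 b2.
move=> /le_trans; apply; rewrite lerD2r lerD2l -[leRHS]mulrA ler_wpM2l //.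
  rewrite mulr_ge0 ?(ltW (eps_gt0 R N N0)) //.
  by apply: le_trans (b1 (2 * m) (lexx _)).
exact: periodic_interface_bound hI hg (periodic_d2_inY _ _ _ _ N0 yY).
Qed.

Lemma blend_defect_linfty (R : realType) (g g1 g2 : R -> R) (N k : nat)
    (F : R) (gamma y : int -> R) (I : pred int) (m G0 G1 G2 : R) (xi : int) :
  (forall r : R, 0 < r -> is_derive r 1 g (g1 r)) ->
  (forall r : R, 0 < r -> is_derive r 1 g1 (g2 r)) ->
  (0 < N)%N -> 0 < m -> inY N F y -> (forall i, m <= d1 N y i) ->
  (forall r, 2 * m <= r -> `|g r| <= G0) ->
  (forall r, 2 * m <= r -> `|g1 r| <= G1) ->
  (forall r, 2 * m <= r -> `|g2 r| <= G2) ->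
  Nperiodic N gamma -> is_interface N k gamma I ->
  `|blend_defect g gamma (d1 N y) xi|
  <= G0 * linfty N (Delta2 (alpha gamma))
     + G1 * linfty_on N I (d2 N y) * (eps N * linfty N (Delta (beta gamma)))
     + eps N ^+ 2 * (G1 * linfty N (blend_d3 N gamma y)
                     + G2 * linfty N (blend_d2sq N gamma y)).
Proof.
move=> dg dg1 N0 m0 yY my b0 b1 b2 hg hI.
have := blend_defect_interface_le R g g1 g2 N k F gamma y I m G0 G1 G2 xi
  dg dg1 N0 m0 yY my b0 b1 b2 hg hI.
move=> /le_trans; apply; have e0 := ltW (eps_gt0 R N N0).
have G00 : 0 <= G0 by apply: le_trans (b0 (2 * m) (lexx _)).
have G10 : 0 <= G1 by apply: le_trans (b1 (2 * m) (lexx _)).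
have G20 : 0 <= G2 by apply: le_trans (b2 (2 * m) (lexx _)).
have pa := periodic_Delta2 _ _ _ (periodic_alpha _ _ _ hg).
have pb := periodic_Delta _ _ _ (periodic_beta _ _ _ hg).
have p3 := periodic_blend_d3 _ _ _ _ _ N0 hg yY.
have p2 := periodic_blend_d2sq _ _ _ _ _ N0 hg yY.
apply: lerD; first apply: lerD.
- by rewrite ler_wpM2l // linfty_ge.
- rewrite mulrA [_ * eps N]mulrC !mulrA ler_wpM2l ?linfty_ge //.
  by rewrite !mulr_ge0 // linfty_on_ge0.
rewrite ler_wpM2l ?exprn_ge0 //; apply: lerD.
  by rewrite ler_wpM2l ?linfty_ge.
rewrite -mulrA ler_wpM2l //.
have := linfty_ge _ _ _ xi N0 p2; have := linfty_ge _ _ _ (xi - 1) N0 p2; lra.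
Qed.

(** Cauchy-Schwarz is applied to each contribution separately; the two
    quadratic terms have the same norm by periodicity, which absorbs the
    factor 1/2. *)
Lemma blend_defect_l2 (R : realType) (g g1 g2 : R -> R) (N k : nat)
    (F : R) (gamma y : int -> R) (I : pred int) (m G0 G1 G2 : R)
    (v : int -> R) :
  (forall r : R, 0 < r -> is_derive r 1 g (g1 r)) ->
  (forall r : R, 0 < r -> is_derive r 1 g1 (g2 r)) ->
  (0 < N)%N -> 0 < m -> inY N F y -> (forall i, m <= d1 N y i) ->
  (forall r, 2 * m <= r -> `|g r| <= G0) ->
  (forall r, 2 * m <= r -> `|g1 r| <= G1) ->
  (forall r, 2 * m <= r -> `|g2 r| <= G2) ->
  Nperiodic N gamma -> is_interface N k gamma I ->
  `|avg N (fun xi => blend_defect g gamma (d1 N y) xi * v xi)|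
  <= (G0 * l2 N (Delta2 (alpha gamma))
      + G1 * linfty_on N I (d2 N y) * (eps N * l2 N (Delta (beta gamma)))
      + eps N ^+ 2 * (G1 * l2 N (blend_d3 N gamma y)
                      + G2 * l2 N (blend_d2sq N gamma y))) * l2 N v.
Proof.
move=> dg dg1 N0 m0 yY my b0 b1 b2 hg hI.
have e0 := ltW (eps_gt0 R N N0).
have G00 : 0 <= G0 by apply: le_trans (b0 (2 * m) (lexx _)).
have G10 : 0 <= G1 by apply: le_trans (b1 (2 * m) (lexx _)).
have G20 : 0 <= G2 by apply: le_trans (b2 (2 * m) (lexx _)).
have p2 := periodic_blend_d2sq _ _ _ _ _ N0 hg yY.
set D2 := Delta2 _; set D1 := Delta _; set W3 := blend_d3 _ _ _.
set W2 := blend_d2sq _ _ _; set L := linfty_on _ _ _.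
have L0 : 0 <= L by exact: linfty_on_ge0.
apply: (@le_trans _ _ (avg N (fun xi =>
    G0 * (`|D2 xi| * `|v xi|) + eps N * G1 * L * (`|D1 xi| * `|v xi|)
    + eps N ^+ 2 * G1 * (`|W3 xi| * `|v xi|)
    + eps N ^+ 2 * G2 / 2 * (`|W2 xi| * `|v xi|)
    + eps N ^+ 2 * G2 / 2 * (`|W2 (xi - 1)| * `|v xi|)))).
  have pt xi : `|blend_defect g gamma (d1 N y) xi * v xi| <=
    G0 * (`|D2 xi| * `|v xi|) + eps N * G1 * L * (`|D1 xi| * `|v xi|)
    + eps N ^+ 2 * G1 * (`|W3 xi| * `|v xi|)
    + eps N ^+ 2 * G2 / 2 * (`|W2 xi| * `|v xi|)
    + eps N ^+ 2 * G2 / 2 * (`|W2 (xi - 1)| * `|v xi|).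
    rewrite normrM.
    have := blend_defect_interface_le R g g1 g2 N k F gamma y I m
      G0 G1 G2 xi dg dg1 N0 m0 yY my b0 b1 b2 hg hI.
    move=> /(ler_wpM2r (normr_ge0 (v xi))) /le_trans; apply.
    by apply: eq_ler; rewrite -/D2 -/D1 -/W3 -/W2 -/L; ring.
  rewrite ler_norml; apply/andP; split.
    rewrite -[leLHS]mulN1r -avgZ; apply: le_avg => xi.
    by have := pt xi; rewrite mulN1r ler_norml => /andP[].
  by apply: le_avg => xi; apply: le_trans (ler_norm _) (pt xi).
rewrite !avgD !avgZ.
have cs (w : int -> R) (c : R) : 0 <= c ->
    c * avg N (fun xi => `|w xi| * `|v xi|) <= c * (l2 N w * l2 N v).
  by move=> c0; rewrite ler_wpM2l // avg_cauchy_schwarz.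
have c2 : 0 <= eps N ^+ 2 :> R by rewrite exprn_ge0.
have := cs D2 _ G00.
have := cs D1 _ (mulr_ge0 (mulr_ge0 e0 G10) L0).
have := cs W3 _ (mulr_ge0 c2 G10).
have c3 : 0 <= eps N ^+ 2 * G2 / 2 by rewrite divr_ge0 // mulr_ge0.
have := cs W2 _ c3.
have := cs (fun xi => W2 (xi - 1)) _ c3; rewrite (l2_pred _ _ _ p2) -/W2.
lra.
Qed.

(** * Strong convexity near the reference state *)

Lemma between_dist (R : realType) (p q c x e : R) :
  Num.min p q <= c <= Num.max p q -> `|p - x| <= e -> `|q - x| <= e ->
  `|c - x| <= e.
Proof.
rewrite ge_min le_max !ler_norml.
move=> /andP[/orP[]h1 /orP[]h2] /andP[? ?] /andP[? ?];
  apply/andP; split; lra.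
Qed.

(** The weight of the squared strain at [xi] after each next-nearest neighbour
    term [(p + q) ^+ 2] of the Hessian is replaced by
    [2 * p ^+ 2 + 2 * q ^+ 2]. *)
Definition hessian_coef {R : realType} (f2 : R -> R) (a b z : int -> R)
    (xi : int) : R :=
  f2 (z xi) + 4 * a xi * f2 (2 * z xi) + 2 * b xi * f2 (z xi + z (xi + 1))
  + 2 * b (xi - 1) * f2 (z (xi - 1) + z xi).

(** The exact remainder has second derivatives at intermediate strains within
    [eta], [2 * eta], [2 * eta] of the reference ones for the three kinds of
    bonds.  Since the bonds enter the Hessian with total weights 1, 4 and 4,
    replacing them by reference values costs
    [M * eta * (1 + 4 * 2 + 4 * 2) = 17 * M * eta].  Replacing the nonlocal
    squares by diagonal ones goes in the right direction because [f2] is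
    nonpositive at the
    reference bonds. *)
Lemma pair_energy_strongly_convex (R : realType) (phi f1 f2 : R -> R)
    (N : nat) (a b z w1 w2 : int -> R) (m M eta kappa : R) :
  (forall r : R, 0 < r -> is_derive r 1 phi (f1 r)) ->
  (forall r : R, 0 < r -> is_derive r 1 f1 (f2 r)) ->
  (forall r, 2 * m <= r -> f2 r <= 0) ->
  (forall p q, m / 2 <= p -> m / 2 <= q -> `|f2 p - f2 q| <= M * `|p - q|) ->
  0 <= M -> 0 < m -> 0 <= eta <= m / 2 ->
  (forall xi, 0 <= a xi <= 1) -> (forall xi, 0 <= b xi <= 1) ->
  Nperiodic N b -> Nperiodic N z -> Nperiodic N w1 -> Nperiodic N w2 ->
  (forall xi, m <= z xi) ->
  (forall xi, kappa <= hessian_coef f2 a b z xi) ->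
  (forall xi, `|w1 xi - z xi| <= eta) -> (forall xi, `|w2 xi - z xi| <= eta) ->
  pair_energy N phi a b w1
    + avg N (fun xi => stress f1 a b w1 xi * (w2 xi - w1 xi))
    + 2^-1 * ((kappa - 17 * M * eta) * avg N (fun xi => (w2 xi - w1 xi) ^+ 2))
  <= pair_energy N phi a b w2.
Proof.
move=> df df1 neg lip M0 m0 /andP[eta0 etam] a01 b01 pb pz p1 p2 mz kz c1 c2.
have nbhd (w : int -> R) : (forall xi, `|w xi - z xi| <= eta) ->
    forall xi, 0 < w xi.
  by move=> h xi; have := h xi; have := mz xi; rewrite ler_norml => ? /andP[]; lra.
have [d0 [d1 [d2 [Hd0 Hd1 Hd2 ->]]]] := pair_energy_expansion R phi f1 f2 N a b
  w1 w2 df df1 pb p1 p2 (nbhd _ c1) (nbhd _ c2).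
rewrite lerD2l ler_pM2l // -avgZ.
pose P (xi : int) : R := f2 (z xi + z (xi + 1)).
pose v (xi : int) : R := w2 xi - w1 xi.
pose s1 (xi : int) : R :=
  (f2 (z xi) + 4 * a xi * f2 (2 * z xi) + 2 * (b xi * P xi) - 13 * (M * eta))
  * v xi ^+ 2.
(* [s1] collects what multiplies [v xi ^+ 2] directly, [s2] what multiplies
   [v (xi + 1) ^+ 2], shifted back by one site. *)
pose s2 (xi : int) : R :=
  (2 * (b (xi - 1) * f2 (z (xi - 1) + z xi)) - 4 * (M * eta)) * v xi ^+ 2.
have lower x c t : m <= x -> t <= x - m / 2 -> `|c - x| <= t ->
    f2 x - M * t <= f2 c.
  move=> mx tx cx; have mc : m / 2 <= c.
    by move: cx; rewrite ler_norml => /andP[]; lra.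
  have := lip x c _ mc; rewrite (distrC x c) => /(_ ltac:(lra)) h.
  have : M * `|c - x| <= M * t by rewrite ler_wpM2l.
  have := ler_norm (f2 x - f2 c); lra.
have ps2 : Nperiodic N s2.
  move=> xi; rewrite /s2 /v pz p1 p2.
  by rewrite (periodicD _ _ _ _ _ pb) (periodicD _ _ _ _ _ pz).
apply: (@le_trans _ _ (avg N (fun xi => s1 xi + s2 (xi + 1)))); last first.
  apply: le_avg => xi; rewrite /s1 /s2 /= !addrK -/(P xi) -/(v xi) -/(v (xi + 1)).
  have hc0 : f2 (z xi) - M * eta <= f2 (d0 xi).
    apply: lower; [exact: mz|have := mz xi; lra|].
    exact: (between_dist _ _ _ _ _ _ (Hd0 xi)).
  have hc1 : f2 (2 * z xi) - 2 * (M * eta) <= f2 (d1 xi).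
    rewrite mulrCA; apply: lower; [have := mz xi; lra|have := mz xi; lra|].
    apply: (between_dist _ _ _ _ _ _ (Hd1 xi));
      by rewrite -mulrBr normrM ger0_norm // ler_wpM2l.
  have hc2 : P xi - 2 * (M * eta) <= f2 (d2 xi).
    have mz1 := mz xi; have mz2 := mz (xi + 1).
    rewrite mulrCA; apply: lower; [lra|lra|].
    have dist2 (w : int -> R) : (forall xi, `|w xi - z xi| <= eta) ->
        `|w xi + w (xi + 1) - (z xi + z (xi + 1))| <= 2 * eta.
      move=> cw; rewrite opprD addrACA; apply: le_trans (ler_normD _ _) _.
      by have := cw xi; have := cw (xi + 1); lra.
    by apply: (between_dist _ _ _ _ _ _ (Hd2 xi)); apply: dist2.
  have P0 : P xi <= 0 by apply: neg; have := mz xi; have := mz (xi + 1); lra.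
  have Me : 0 <= M * eta by rewrite mulr_ge0.
  have /andP[a0 a1] := a01 xi; have /andP[b0 b1] := b01 xi.
  set V := v xi; set V' := v (xi + 1); set k := M * eta.
  have V2 := sqr_ge0 V; have V2' := sqr_ge0 V'; have VV := sqr_ge0 (V + V').
  have t0 : (f2 (z xi) - k) * V ^+ 2 <= f2 (d0 xi) * V ^+ 2.
    by rewrite ler_wpM2r.
  have t1 : 4 * a xi * f2 (2 * z xi) * V ^+ 2 - 8 * k * V ^+ 2
      <= 4 * a xi * f2 (d1 xi) * V ^+ 2.
    rewrite -mulrBl ler_wpM2r //.
    apply: (@le_trans _ _ (4 * a xi * (f2 (2 * z xi) - 2 * k))).
      by rewrite -/k in Me; nra.
    by rewrite ler_wpM2l // mulr_ge0.
  have t2 : (2 * (b xi * P xi) - 4 * k) * (V ^+ 2 + V' ^+ 2)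
      <= b xi * f2 (d2 xi) * (V + V') ^+ 2.
    have sq : (V + V') ^+ 2 <= 2 * (V ^+ 2 + V' ^+ 2).
      by have := sqr_ge0 (V - V'); nra.
    apply: (@le_trans _ _ ((b xi * P xi - 2 * k) * (V + V') ^+ 2)).
      have : b xi * P xi - 2 * k <= 0.
        rewrite subr_le0; apply: (@le_trans _ _ 0); first by rewrite mulr_ge0_le0.
        by rewrite mulr_ge0.
      move: (b xi * P xi) => bP; nra.
    rewrite ler_wpM2r //.
    apply: (@le_trans _ _ (b xi * (P xi - 2 * k))); last by rewrite ler_wpM2l.
    rewrite -/k in Me; nra.
  lra.
rewrite avgD (avg_succ _ _ _ ps2) -avgD; apply: le_avg => xi.
rewrite /s1 /s2 -mulrDl ler_wpM2r ?sqr_ge0 //.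
have := kz xi; rewrite /hessian_coef -/(P xi); lra.
Qed.

(** * Compactness and existence of constrained minimizers *)

(** The periodic lattice function with given values on 0, ..., n; row vectors
    are used because their bounded closed sets are compact. *)
Definition periodic_ext {R : realType} {n : nat} (v : 'rV[R]_n.+1)
    (xi : int) : R :=
  v ord0 (inord (absz (xi %% n.+1%:Z)%Z)).

Lemma periodic_ext_periodic (R : realType) (n : nat) (v : 'rV[R]_n.+1) :
  Nperiodic n.+1 (periodic_ext v).
Proof. by move=> xi; rewrite /periodic_ext modzDr. Qed.

Lemma periodic_ext_surj (R : realType) (n : nat) (u : int -> R) :
  Nperiodic n.+1 u -> exists v : 'rV[R]_n.+1, periodic_ext v = u.
Proof.
move=> pu; exists (\row_j u j%:Z); apply: funext => xi; rewrite /periodic_ext mxE.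
have r0 := modz_ge0 xi (isT : n.+1%:Z != 0).
have rn := ltz_pmod xi (isT : 0 < n.+1%:Z).
rewrite inordK; last by move: r0 rn; lia.
rewrite gez0_abs //.
by rewrite [in RHS](divz_eq xi n.+1) addrC periodicZ.
Qed.

Lemma continuous_avg (R : realType) (T : topologicalType) (N : nat)
    (G : int -> T -> R) :
  (forall xi, continuous (G xi)) -> continuous (fun v => avg N (G^~ v)).
Proof.
move=> cG v; rewrite /avg; apply: cvgM; first exact: cvg_cst.
elim: (index_iota 1 N.+1) => [|i s IH].
  by under eq_fun do rewrite big_nil; rewrite big_nil; exact: cvg_cst.
under eq_fun do rewrite big_cons; rewrite big_cons.
by apply: cvgD => //; exact: cG.
Qed.

Lemma continuous_periodic_ext (R : realType) (n : nat) (xi : int) :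
  continuous (fun v : 'rV[R]_n.+1 => periodic_ext v xi).
Proof. exact: coord_continuous. Qed.

Lemma continuous_d1 (R : realType) (T : topologicalType) (N : nat)
    (U : T -> int -> R) (xi : int) :
  (forall i, continuous (U^~ i)) -> continuous (fun v => d1 N (U v) xi).
Proof.
move=> cU v; rewrite /d1; apply: cvgMr_tmp.
by apply: cvgB; exact: cU.
Qed.

Lemma continuous_U12norm (R : realType) (T : topologicalType) (N : nat)
    (U : T -> int -> R) :
  (forall i, continuous (U^~ i)) -> continuous (fun v => U12norm N (U v)).
Proof.
move=> cU v.
apply: (@continuous_comp _ _ _ (fun v => avg N (fun xi => `|d1 N (U v) xi| ^+ 2))
  Num.sqrt v); last exact: sqrt_continuous.
apply: (continuous_avg _ _ _ (fun xi v => `|d1 N (U v) xi| ^+ 2)) => xi w.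
by apply: cvgM; apply: cvg_norm; exact: continuous_d1.
Qed.

(** The potential is continuous for positive arguments only; clamping makes it
    continuous everywhere without changing it where the energy is used. *)
Lemma continuous_clamp (R : realType) (phi : R -> R) (m : R) :
  0 < m -> (forall r : R, 0 < r -> {for r, continuous phi}) ->
  continuous (fun r : R => phi (Num.max m r)).
Proof.
move=> m0 cphi r; apply: (continuous_comp (g := phi)); last first.
  by apply: cphi; rewrite lt_max m0.
by apply: continuous_max; [exact: cvg_cst|exact: cvg_id].
Qed.

(** A bound on the gradient controls the distance to the value at 0, and the
    mean-zero condition then controls the value at 0 itself. *)
Lemma mean_zero_bounded (R : realType) (N : nat) (D : R) (u : int -> R) :
  (0 < N)%N -> inU N u -> (forall xi, `|d1 N u xi| <= D) ->
  forall i : nat, (i <= N)%N -> `|u i%:Z| <= 2 * (N%:R * D).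
Proof.
move=> N0 [pu su] uD.
have D0 : 0 <= D by apply: le_trans (uD 0).
have N1 : 1 <= N%:R :> R by rewrite ler1n.
have step xi : `|u (xi + 1) - u xi| <= D.
  have := uD (xi + 1); rewrite /d1 addrK invrK normrM (ger0_norm (ler0n R N)).
  have := normr_ge0 (u (xi + 1) - u xi); nra.
have dist (i : nat) : `|u i%:Z - u 0| <= i%:R * D.
  elim: i => [|i IH]; first by rewrite subrr normr0 mul0r.
  rewrite (_ : i.+1%:Z = i%:Z + 1); last by rewrite intS addrC.
  rewrite -(subrK (u i) (u (i%:Z + 1))) -addrA.
  apply: le_trans (ler_normD _ _) _; rewrite -natr1 mulrDl mul1r [leRHS]addrC.
  by apply: lerD; [exact: step|exact: IH].
have dist' (i : nat) : (i <= N)%N -> `|u i%:Z - u 0| <= N%:R * D.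
  by move=> iN; apply: le_trans (dist i) _; rewrite ler_wpM2r // ler_nat.
have u0 : `|u 0| <= N%:R * D.
  have E : N%:R * u 0 = - \sum_(1 <= i < N.+1) (u i%:Z - u 0).
    rewrite big_split /= su add0r sumrN opprK sumr_const_nat subSS subn0.
    by rewrite mulr_natl.
  have : `|N%:R * u 0| <= \sum_(1 <= i < N.+1) N%:R * D.
    rewrite E normrN; apply: le_trans (ler_norm_sum _ _ _) _.
    rewrite big_nat_cond [leRHS]big_nat_cond.
    apply: ler_sum => i /andP[/andP[_ iN] _].
    exact: dist'.
  rewrite sumr_const_nat subSS subn0 -[N%:R * D *+ N]mulr_natl.
  rewrite normrM (ger0_norm (ler0n R N)).
  by rewrite ler_pM2l // ltr0n.
move=> i iN; rewrite -(subrK (u 0) (u i)); apply: le_trans (ler_normD _ _) _.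
by rewrite mulr_natl mulr2n lerD // dist'.
Qed.

(** Closed by continuity, and bounded because the norm controls the gradient
    pointwise and the gradient controls a mean-zero function. *)
Lemma compact_ball (R : realType) (n : nat) (r : R) : 0 <= r ->
  compact [set v : 'rV[R]_n.+1 | inU n.+1 (periodic_ext v) /\
                                 U12norm n.+1 (periodic_ext v) <= r].
Proof.
move=> r0; set N := n.+1; set K := mkset _.
have e0 := eps_gt0 R N isT.
have s0 : 0 < Num.sqrt (eps N) :> R by rewrite sqrtr_gt0.
pose D := r / Num.sqrt (eps N).
pose C := 2 * (N%:R * D).
have KC : (K `<=` [set v | forall i, `[- C, C] (v ord0 i)])%classic.
  move=> v [vU vr] i /=; rewrite in_itv /= -ler_norml.
  have uD xi : `|d1 N (periodic_ext v) xi| <= D.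
    apply: (norm_le_of_l2 R N (d1 N (periodic_ext v)) D xi isT).
    - by apply: periodic_d1; case: vU.
    - by rewrite /D divr_ge0 // ltW.
    - by rewrite /D mulrC divfK ?gt_eqF.
  have := mean_zero_bounded R N D _ isT vU uD i (ltnW (ltn_ord i)).
  rewrite /periodic_ext modz_small ?ltz_nat ?ltn_ord //= (_ : inord i = i) //.
  by apply: val_inj; rewrite /= inordK.
apply: subclosed_compact KC; last first.
  by apply: (rV_compact (A := fun=> `[- C, C]%classic)) => _; exact: segment_compact.
have cavg : continuous (fun v : 'rV[R]_n.+1 => avg N (periodic_ext v)).
  by apply: continuous_avg => xi; exact: continuous_periodic_ext.
have cnorm : continuous (fun v : 'rV[R]_n.+1 => U12norm N (periodic_ext v)).
  by apply: continuous_U12norm => xi; exact: continuous_periodic_ext.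
have -> : K = ((fun v : 'rV[R]_n.+1 => avg N (periodic_ext v)) @^-1` [set x | x = 0]
   `&` (fun v : 'rV[R]_n.+1 => U12norm N (periodic_ext v))
         @^-1` [set x | x <= r])%classic.
  apply/seteqP; split=> v /=; rewrite /K /= /inU.
    by move=> [[_ /sumE_avg-> //] ?].
  by move=> [/sumE_avg ? ?]; do !split=> //; [exact: periodic_ext_periodic|auto].
apply: closedI; apply: preimage_closed => [v _|].
- exact: cavg.
- exact: closed_eq.
- exact: cnorm.
- exact: closed_le.
Qed.

Lemma continuous_pair_energy (R : realType) (T : topologicalType) (N : nat)
    (psi : R -> R) (a b : int -> R) (Z : T -> int -> R) :
  continuous psi -> (forall i, continuous (Z^~ i)) ->
  continuous (fun v => pair_energy N psi a b (Z v)).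
Proof.
move=> cpsi cZ.
have cpsiZ (g : T -> R) : continuous g -> continuous (fun v => psi (g v)).
  move=> cg v; apply: (continuous_comp (f := g) (g := psi)); first exact: cg.
  exact: cpsi.
apply: (continuous_avg _ _ _ (fun xi v => psi (Z v xi) + a xi * psi (2 * Z v xi)
  + b xi * psi (Z v xi + Z v (xi + 1)))) => xi v.
apply: cvgD; first apply: cvgD.
- exact: (cpsiZ (Z^~ xi)).
- apply: cvgMl_tmp; apply: (cpsiZ (fun v => 2 * Z v xi)) => w.
  by apply: cvgMl_tmp; exact: cZ.
- apply: cvgMl_tmp; apply: (cpsiZ (fun v => Z v xi + Z v (xi + 1))) => w.
  by apply: cvgD; exact: cZ.
Qed.

Lemma continuous_pairing (R : realType) (T : topologicalType) (N : nat)
    (f : int -> R) (U : T -> int -> R) :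
  (forall i, continuous (U^~ i)) -> continuous (fun v => pairing N f (U v)).
Proof.
move=> cU; apply: (continuous_avg _ _ _ (fun xi v => f xi * U v xi)) => xi v.
by apply: cvgMl_tmp; exact: cU.
Qed.

Lemma continuous_total_energy (R : realType) (T : topologicalType) (N : nat)
    (psi : R -> R) (f a b y : int -> R) (U : T -> int -> R) :
  continuous psi -> (forall i, continuous (U^~ i)) ->
  continuous (fun v => pair_energy N psi a b (d1 N (fun xi => y xi + U v xi))
                       - pairing N f (fun xi => y xi + U v xi)).
Proof.
move=> cpsi cU.
have cW i : continuous (fun v => y i + U v i).
  by move=> v; apply: cvgD; [exact: cvg_cst|exact: cU].
move=> v; apply: cvgB; last exact: (continuous_pairing _ _ _ f _ cW).
apply: (continuous_pair_energy _ _ _ psi a b _ cpsi) => xi.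
exact: (continuous_d1 _ _ _ (fun v i => y i + U v i)).
Qed.

(** Extreme value theorem for the energy with clamped potential, on the compact
    ball of displacements. *)
Lemma ball_minimizer (R : realType) (phi : R -> R) (N : nat) (F : R)
    (f a b y : int -> R) (m r : R) :
  (0 < N)%N -> 0 < m -> (forall t : R, 0 < t -> {for t, continuous phi}) ->
  inY N F y -> 0 <= r ->
  (forall w, inY N F w -> U12norm N (fun xi => w xi - y xi) <= r ->
     forall xi, m <= d1 N w xi) ->
  let E w := pair_energy N phi a b (d1 N w) - pairing N f w in
  exists w, [/\ inY N F w, U12norm N (fun xi => w xi - y xi) <= r &
    forall w', inY N F w' -> U12norm N (fun xi => w' xi - y xi) <= r ->
      E w <= E w'].
Proof.
case: N => // n _ m0 cphi yY r0 dm E; set N := n.+1.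
pose psi t := phi (Num.max m t).
pose W (v : 'rV[R]_n.+1) (xi : int) : R := y xi + periodic_ext v xi.
pose G v := pair_energy N psi a b (d1 N (W v)) - pairing N f (W v).
have cG : continuous G.
  by apply: continuous_total_energy;
    [exact: continuous_clamp|exact: continuous_periodic_ext].
have psiE w : inY N F w -> U12norm N (fun xi => w xi - y xi) <= r ->
    pair_energy N psi a b (d1 N w) = pair_energy N phi a b (d1 N w).
  move=> wY wr; apply: eq_avg => xi; rewrite /psi.
  have := dm w wY wr xi; have := dm w wY wr (xi + 1) => h1 h2.
  by rewrite !max_r //; lra.
have WB v : (fun xi => W v xi - y xi) = periodic_ext v.
  by apply: funext => xi; rewrite /W addrC addKr.
pose K := [set v : 'rV[R]_n.+1 | inU n.+1 (periodic_ext v) /\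
                                 U12norm n.+1 (periodic_ext v) <= r]%classic.
have K0 : (K !=set0)%classic.
  exists 0; rewrite /K /= (_ : periodic_ext 0 = fun=> 0); last first.
    by apply: funext => xi; rewrite /periodic_ext mxE.
  split; first by split=> //; rewrite big1.
  rewrite /U12norm (eq_l2 _ _ _ (fun xi => 0 * d1 N (fun=> 0) xi)).
    by rewrite l2Z normr0 mul0r.
  by move=> xi; rewrite /d1 subrr !mul0r.
have [v vK vmin] := EVT_min_rV K0 (compact_ball R n r r0)
  (continuous_subspaceT cG).
have [vU vr] := set_mem vK.
exists (W v); split; first exact: inY_addU.
  by rewrite WB.
move=> w' wY' wr'.
have [v' v'E] := periodic_ext_surj R n _ (inY_subU _ _ _ _ _ yY wY').1.
have W' : W v' = w'.
  by apply: funext => xi; rewrite /W v'E addrC subrK.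
have : G v <= G v'.
  by apply: vmin; apply/mem_set; rewrite /K /= v'E; split=> //; exact: inY_subU wY'.
by rewrite /G W' !psiE // ?WB //; exact: inY_addU.
Qed.

(** * Minimizers near an almost stationary state *)

Lemma U12normC (R : realType) (N : nat) (v w : int -> R) :
  U12norm N (fun xi => v xi - w xi) = U12norm N (fun xi => w xi - v xi).
Proof. by apply: eq_l2 => xi; rewrite !d1B distrC. Qed.

Lemma U12norm_triangle (R : realType) (N : nat) (u v w : int -> R) :
  U12norm N (fun xi => u xi - w xi)
  <= U12norm N (fun xi => u xi - v xi) + U12norm N (fun xi => v xi - w xi).
Proof.
apply: le_trans (l2_triangle _ _ _ _); apply: eq_ler.
by apply: eq_l2 => xi; rewrite !d1B; congr `| _ |; ring.
Qed.

(** With a vanishing gradient the bound of [mean_zero_bounded] is 0. *)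
Lemma U12norm_eq0 (R : realType) (N : nat) (u : int -> R) :
  (0 < N)%N -> inU N u -> U12norm N u = 0 -> u = fun=> 0.
Proof.
move=> N0 uU un; apply: funext => xi; have [pu su] := uU.
have [i [/andP[_ iN] ->]] := periodic_site R N xi N0; last by [].
have := mean_zero_bounded R N 0 u N0 uU _ i iN.
rewrite !mulr0 normr_le0 => h; apply/eqP/h => j.
apply: (norm_le_of_l2 R N (d1 N u)) => //; first exact: periodic_d1.
by rewrite mulr0 -un.
Qed.

(** The analytic core.  A state with residual at most [T] in the dual norm,
    around which the energy is strongly convex with modulus [kappa], has a
    minimizer within [2 * T / kappa], provided that this distance is less than
    the radius on which convexity is known. *)
Lemma nearby_minimizer (R : realType) (phi f1 f2 : R -> R) (N : nat) (F : R)
    (f a b y : int -> R) (E : (int -> R) -> R) (m M eta kappa0 T : R) :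
  (forall r : R, 0 < r -> is_derive r 1 phi (f1 r)) ->
  (forall r : R, 0 < r -> is_derive r 1 f1 (f2 r)) ->
  (forall r0, 0 < r0 -> exists M, forall r, r0 <= r -> `|f2 r| <= M) ->
  (forall r, 2 * m <= r -> f2 r <= 0) ->
  (forall p q, m / 2 <= p -> m / 2 <= q -> `|f2 p - f2 q| <= M * `|p - q|) ->
  0 <= M -> 0 < m -> 0 < eta <= m / 2 ->
  (forall xi, 0 <= a xi <= 1) -> (forall xi, 0 <= b xi <= 1) ->
  (0 < N)%N -> Nperiodic N b -> inY N F y ->
  (forall xi, m <= d1 N y xi) ->
  (forall xi, kappa0 <= hessian_coef f2 a b (d1 N y) xi) ->
  (forall w, admissible N F w ->
     E w = pair_energy N phi a b (d1 N w) - pairing N f w) ->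
  0 <= T ->
  (forall u, inU N u ->
     `|avg N (fun xi => stress f1 a b (d1 N y) xi * d1 N u xi) - pairing N f u|
     <= T * U12norm N u) ->
  let kappa := kappa0 - 17 * M * eta in
  0 < kappa -> 2 * T / kappa < Num.sqrt (eps N) * eta ->
  exists2 yg, locally_unique_minimizer N F E yg &
    U12norm N (fun xi => y xi - yg xi) <= 2 * T / kappa.
Proof.
move=> df df1 bnd neg lip M0 m0 /andP[eta0 etam] a01 b01 N0 pb yY my ky hE T0 res.
move=> kappa k0 small; have e0 := eps_gt0 R N N0.
pose r := Num.sqrt (eps N) * eta.
have r0 : 0 < r by rewrite mulr_gt0 ?sqrtr_gt0.
pose near_y w := inY N F w /\ U12norm N (fun xi => w xi - y xi) <= r.
have box w : near_y w -> forall xi, `|d1 N w xi - d1 N y xi| <= eta.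
  move=> [wY wr] xi; rewrite -d1B.
  apply: (norm_le_of_l2 R N (d1 N (fun xi => w xi - y xi)) eta xi N0 _ (ltW eta0) wr).
  by apply: periodic_d1; case: (inY_subU _ _ _ _ _ yY wY).
have low w : near_y w -> forall xi, m / 2 <= d1 N w xi.
  move=> /box h xi; have := h xi; rewrite ler_norml => /andP[+ _].
  by have := my xi; lra.
have adm w : near_y w -> admissible N F w.
  move=> h; split; first by case: h.
  by move=> xi; apply: lt_le_trans (low w h xi); rewrite divr_gt0.
pose E0 w := pair_energy N phi a b (d1 N w) - pairing N f w.
pose dE w u :=
  avg N (fun xi => stress f1 a b (d1 N w) xi * d1 N u xi) - pairing N f u.
have convex w1 w2 : near_y w1 -> near_y w2 ->
    E0 w1 + dE w1 (fun xi => w2 xi - w1 xi)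
      + 2^-1 * (kappa * U12norm N (fun xi => w2 xi - w1 xi) ^+ 2) <= E0 w2.
  move=> n1 n2; have := pair_energy_strongly_convex R phi f1 f2 N a b (d1 N y)
    (d1 N w1) (d1 N w2) m M eta kappa0 df df1 neg lip M0 m0 _ a01 b01 pb
    (periodic_d1_inY _ _ _ _ yY) (periodic_d1_inY _ _ _ _ n1.1)
    (periodic_d1_inY _ _ _ _ n2.1) my ky (box _ n1) (box _ n2).
  rewrite (ltW eta0) etam => /(_ isT).
  rewrite /E0 /dE sqr_l2 -/kappa.
  rewrite (eq_avg _ _ (fun xi => stress _ _ _ _ _ * d1 N _ _)
    (fun xi => stress f1 a b (d1 N w1) xi * (d1 N w2 xi - d1 N w1 xi))); last first.
    by move=> xi; rewrite d1B.
  rewrite (eq_avg _ _ (fun xi => d1 N _ _ ^+ 2)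
    (fun xi => (d1 N w2 xi - d1 N w1 xi) ^+ 2)); last by move=> xi; rewrite d1B.
  have : pairing N f w2 = pairing N f w1 + 1 * pairing N f (fun xi => w2 xi - w1 xi).
    rewrite -pairing_lin; congr pairing; apply: funext => xi.
    by rewrite mul1r addrC subrK.
  by rewrite mul1r; lra.
have near_self : near_y y.
  split=> //; rewrite /U12norm (eq_l2 _ _ _ (fun xi => 0 * d1 N y xi)).
    by rewrite l2Z normr0 mul0r ltW.
  by move=> xi; rewrite d1B subrr mul0r.
have cphi (t : R) : 0 < t -> {for t, continuous phi}.
  move=> t0; apply/differentiable_continuous/derivable1_diffP.
  by have := df t t0 => h; exact: ex_derive.
have [w0 [w0Y w0r w0min]] := ball_minimizer R phi N F f a b y (m / 2) r N0
  (divr_gt0 m0 (@ltr0n R 2)) cphi yY (ltW r0)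
  (fun w wY wr => low w (conj wY wr)).
have n0 : near_y w0 by [].
pose d := U12norm N (fun xi => w0 xi - y xi).
have dT : d <= 2 * T / kappa.
  have d0 : 0 <= d by exact: l2_ge0.
  have h1 := convex y w0 near_self n0.
  have h2 : E0 w0 <= E0 y by apply: w0min; [exact: yY|exact: near_self.2].
  have := res _ (inY_subU _ _ _ _ _ yY w0Y).
  rewrite -/(dE y _) -/d ler_norml => /andP[h3 _].
  rewrite ler_pdivlMr //; rewrite leNgt; apply/negP => h4.
  move: d0; rewrite le_eqVlt => /orP[/eqP d0|d0].
    by move: h4; rewrite -d0 mul0r; lra.
  have : 0 < d * (d * kappa - 2 * T) by rewrite mulr_gt0 // subr_gt0.
  by move: h1 h2 h3; rewrite -/d; lra.
have rho0 : 0 < r - d by rewrite subr_gt0; exact: le_lt_trans dT small.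
have ball w : inY N F w -> U12norm N (fun xi => w xi - w0 xi) < r - d -> near_y w.
  move=> wY wr; split=> //; apply: le_trans (U12norm_triangle _ _ _ w0 _) _.
  by move: wr; rewrite -/d; lra.
have min0 : local_minimizer N F E w0.
  split; first exact: adm.
  exists (r - d) => // w wA wr; rewrite !hE //; last exact: adm.
  by have [wY wr'] := ball w wA.1 wr; exact: w0min.
exists w0; last by rewrite U12normC.
split=> //; exists (r - d) => // w wmin wr.
have wA := wmin.1; have nw := ball w wA.1 wr.
have stat w' u : local_minimizer N F E w' -> inU N u -> dE w' u = 0.
  move=> w'min uU; rewrite /dE (stationarity R phi f1 f2 N F f a b E w' u) //.
  by rewrite subrr.
have h1 := convex w0 w n0 nw; have h2 := convex w w0 nw n0.
rewrite (stat w0) // in h1; last exact: (inY_subU _ _ _ _ _ w0Y wA.1).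
rewrite (stat w) // in h2; last exact: (inY_subU _ _ _ _ _ wA.1 w0Y).
rewrite U12normC in h2; have wU := inY_subU _ _ _ _ _ w0Y wA.1.
have n00 : U12norm N (fun xi => w xi - w0 xi) = 0.
  apply/eqP; rewrite -sqrf_eq0 eq_le sqr_ge0 andbT.
  by rewrite -(pmulr_rle0 _ k0); lra.
apply: funext => xi; apply/eqP; rewrite -subr_eq0.
by have := U12norm_eq0 R N _ N0 wU n00 => /(congr1 (@^~ xi)) /= ->.
Qed.

(** * The error estimate for the blended energy *)

Lemma hessian_coef_blend (R : realType) (N : nat) (phi : R -> R)
    (gamma y : int -> R) (xi : int) :
  hessian_coef (derive1n 2 phi) (alpha gamma) (beta gamma) (d1 N y) xi
  = Acoef N phi y xi + 2 * blend_defect (derive1n 2 phi) gamma (d1 N y) xi.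
Proof.
rewrite /hessian_coef /Acoef /blend_defect; move: (derive1n 2 phi) => f2; ring.
Qed.

Lemma stress_blend (R : realType) (f1 : R -> R) (gamma z : int -> R) (xi : int) :
  stress f1 (alpha gamma) (beta gamma) z xi
  = stress f1 (fun=> 0) (fun=> 1) z xi + blend_defect f1 gamma z xi.
Proof. by rewrite /stress /blend_defect; ring. Qed.

Theorem corollary5p1 (R : realType) (phi : R -> R) (rs : R)
    (hphi : is_potential phi rs) :
  exists (delta1 : R -> R)
         (delta2 : R -> R -> R -> R -> R -> (int -> R) -> R),
  forall (N : nat) (hN : (0 < N)%N) (F : R) (hF : 0 < F)
    (f : int -> R) (hf : inU N f)
    (y : int -> R) (hy : local_minimizer N F (Phi_total N phi f) y)
    (hA : 0 < minper N (Acoef N phi y))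
    (hmin : rs / 2 <= minper N (d1 N y))
    (k : nat) (hk : (0 < k)%N)
    (gamma : int -> R) (hgamma : blending N gamma)
    (I : pred int) (hI : is_interface N k gamma I)
    (C1g C2g : R)
    (hb2 : eps N * l2 N (Delta (beta gamma))
           <= C1g * eps N `^ (3 / 2) * k%:R `^ (- (1 / 2)))
    (hboo : eps N * linfty N (Delta (beta gamma))
            <= C1g * eps N * k%:R^-1)
    (ha2 : l2 N (Delta2 (alpha gamma))
           <= C2g * eps N `^ (1 / 2) * k%:R `^ (- (3 / 2)))
    (haoo : linfty N (Delta2 (alpha gamma)) <= C2g * k%:R ^- 2),
  let e : R := eps N in
  let K : R := k%:R in
  let Amin := minper N (Acoef N phi y) in
  let ymin := minper N (d1 N y) in
  let C (i : nat) := Csup phi i (2 * ymin) in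
  let bet := beta gamma in
  let y2I := linfty_on N I (d2 N y) in
  let w3 := fun xi : int => (1 - bet (xi - 1)) * d3 N y xi in
  let w2 := fun xi : int => (1 - bet xi) * d2 N y xi ^+ 2 in
  [/\ 0 < delta1 Amin,
      0 < delta2 ymin Amin (C 1%N) (C 2%N) (C 3%N) gamma &
      2 * K ^- 2 * C2g * C 2%N + 2 * e * K^-1 * C1g * C 3%N * y2I
        + 2 * e ^+ 2 * (C 3%N * linfty N w3 + C 4%N * linfty N w2)
        <= delta1 Amin ->
      K `^ (- (3 / 2)) * C2g * C 1%N
        + e * K `^ (- (1 / 2)) * C1g * C 2%N * y2I
        + e `^ (3 / 2) * (C 2%N * l2 N w3 + C 3%N * l2 N w2)
        <= delta2 ymin Amin (C 1%N) (C 2%N) (C 3%N) gamma ->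
      exists2 yg : int -> R,
        locally_unique_minimizer N F (Phi_qce_total N phi gamma f) yg &
        U12norm N (fun xi => y xi - yg xi)
          <= 4 / Amin *
             (e `^ (1 / 2) * K `^ (- (3 / 2)) * C2g * C 1%N
              + e `^ (3 / 2) * K `^ (- (1 / 2)) * C1g * C 2%N * y2I
              + e ^+ 2 * (C 2%N * l2 N w3 + C 3%N * l2 N w2))].
Proof.
(* [eta] is the radius of the strain box: within it strains stay above half
   their minimum and, as [68 = 4 * 17], the Hessian bound drops by at most
   [A / 4]; the summand 1 only avoids a vanishing denominator.  The value of
   [delta2] makes [4 / A * T] at most half of the radius [sqrt eps * eta]. *)
pose eta (m A : R) := Num.min (m / 2) (A / (68 * (Csup phi 3 (m / 2) + 1))).
exists (fun A => A / 4), (fun m A _ _ _ _ => eta m A * A / 8).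
move=> N hN F hF f hf y hy hA hmin k hk gamma hgamma I hI C1g C2g.
move=> hb2 hboo ha2 haoo e K Amin ymin C bet y2I w3 w2.
have [rs0 _ _] : [/\ 0 < rs,
  (forall r : R, 0 < r -> r < rs -> 0 < derive1n 2 phi r) &
  (forall r : R, rs < r -> derive1n 2 phi r < 0)] by case: hphi.
have ym0 : 0 < ymin by apply: lt_le_trans hmin; rewrite divr_gt0.
pose M := Csup phi 3 (ymin / 2).
have ym20 : 0 < ymin / 2 by rewrite divr_gt0.
have M0 : 0 <= M by exact: (Csup_ge0 R phi rs 3 _ hphi isT ym20).
have M1 : 0 < M + 1 by rewrite ltr_wpDl.
have A0 : 0 < Amin := hA.
have eta0 : 0 < eta ymin Amin by rewrite lt_min ym20 divr_gt0 // mulr_gt0.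
have etam : eta ymin Amin <= ymin / 2 by rewrite ge_min lexx.
have etaM : 17 * M * eta ymin Amin <= Amin / 4.
  have h : eta ymin Amin * (68 * (M + 1)) <= Amin.
    by rewrite -ler_pdivlMr ?mulr_gt0 // ge_min lexx orbT.
  by move: eta0 h; move: (eta _ _) => t; nra.
split; [by rewrite divr_gt0|by rewrite divr_gt0 // mulr_gt0|move=> H1 H2].
have yY : inY N F y by case: hy => -[].
have pz := periodic_d1_inY _ _ _ _ yY.
have my xi : ymin <= d1 N y xi by exact: minper_le.
have [pg _] := hgamma.
have e0 : 0 < e by exact: eps_gt0.
have C2m : 0 < 2 * ymin by rewrite mulr_gt0.
have Cge i r : (i <= 4)%N -> 2 * ymin <= r -> `|derive1n i phi r| <= C i.
  by move=> i4; exact: (Csup_ge R phi rs i _ _ hphi i4 C2m).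
have C0 i : (i <= 4)%N -> 0 <= C i.
  by move=> i4; exact: (Csup_ge0 R phi rs i _ hphi i4 C2m).
have y2I0 : 0 <= y2I by exact: linfty_on_ge0.
have der i (r : R) : (i < 4)%N -> 0 < r ->
    is_derive r 1 (derive1n i phi) (derive1n i.+1 phi r).
  by move=> i4; exact: (potential_is_derive R phi rs i r hphi i4).
pose kappa0 := Amin - Amin / 4.
have hess xi : kappa0
    <= hessian_coef (derive1n 2 phi) (alpha gamma) (beta gamma) (d1 N y) xi.
  rewrite hessian_coef_blend.
  have hAxi : Amin <= Acoef N phi y xi.
    apply: (minper_le R N (Acoef N phi y) xi hN) => x.
    by rewrite /Acoef pz !(periodicD _ _ _ _ _ pz).
  have := blend_defect_linfty R (derive1n 2 phi) (derive1n 3 phi) (derive1n 4 phi)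
    N k F gamma y I ymin (C 2%N) (C 3%N) (C 4%N) xi (fun r => der 2%N r isT)
    (fun r => der 3%N r isT) hN ym0 yY my (fun r => Cge 2%N r isT)
    (fun r => Cge 3%N r isT) (fun r => Cge 4%N r isT) pg hI.
  rewrite -/y2I -/e -[blend_d3 N gamma y]/w3 -[blend_d2sq N gamma y]/w2.
  have h1 := ler_wpM2l (C0 2%N isT) haoo.
  have h2 := ler_wpM2l (mulr_ge0 (C0 3%N isT) y2I0) hboo.
  move: H1 h1 h2 hAxi; rewrite -/e -/K /kappa0.
  move: (blend_defect _ _ _ _) => D.
  move: (Acoef _ _ _ _) (C 2%N) (C 3%N) (C 4%N).
  move: (linfty _ _) (linfty _ _) (linfty _ _) (linfty _ _).
  move=> x1 x2 x3 x4 a c2 c3 c4 H1 h1 h2 hAxi; rewrite ler_norml => /andP[h3 _].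
  move: (K ^- 2) (K^-1) H1 h1 h2 => K2 K1 H1 h1 h2.
  by clear -H1 h1 h2 h3 hAxi; lra.
pose T := e `^ (1 / 2) * K `^ (- (3 / 2)) * C2g * C 1%N
  + e `^ (3 / 2) * K `^ (- (1 / 2)) * C1g * C 2%N * y2I
  + e ^+ 2 * (C 2%N * l2 N w3 + C 3%N * l2 N w2).
have h1 := ler_wpM2l (C0 1%N isT) ha2.
have h2 := ler_wpM2l (mulr_ge0 (C0 2%N isT) y2I0) hb2.
have leT : C 1%N * l2 N (Delta2 (alpha gamma))
    + C 2%N * y2I * (e * l2 N (Delta (beta gamma)))
    + e ^+ 2 * (C 2%N * l2 N w3 + C 3%N * l2 N w2) <= T.
  rewrite /T lerD2r; apply: lerD.
    by apply: le_trans h1 _; apply: eq_ler; rewrite -/e -/K; ring.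
  by apply: le_trans h2 _; apply: eq_ler; rewrite -/e -/K; ring.
have T0 : 0 <= T.
  apply: le_trans leT; have l0 v := l2_ge0 R N v.
  exact: (addr_ge0
    (addr_ge0 (mulr_ge0 (C0 1%N isT) (l0 _))
       (mulr_ge0 (mulr_ge0 (C0 2%N isT) y2I0) (mulr_ge0 (ltW e0) (l0 _))))
    (mulr_ge0 (exprn_ge0 2 (ltW e0))
       (addr_ge0 (mulr_ge0 (C0 2%N isT) (l0 _)) (mulr_ge0 (C0 3%N isT) (l0 _))))).
have Tsmall : T <= Num.sqrt e * (eta ymin Amin * Amin / 8).
  have -> : T = e `^ (1 / 2) * (K `^ (- (3 / 2)) * C2g * C 1%N
      + e * K `^ (- (1 / 2)) * C1g * C 2%N * y2I
      + e `^ (3 / 2) * (C 2%N * l2 N w3 + C 3%N * l2 N w2)).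
    have E1 : e `^ (3 / 2) = e `^ (1 / 2) * e.
      transitivity (e `^ (1 / 2) * e `^ 1); last by rewrite powRr1 ?(ltW e0).
      rewrite -powRD; last by rewrite (gt_eqF e0) implybT.
      by congr (_ `^ _); field.
    have E2 : e ^+ 2 = e `^ (1 / 2) * e `^ (3 / 2).
      rewrite -powRD; last by rewrite (gt_eqF e0) implybT.
      by rewrite -powR_mulrn ?(ltW e0) //; congr (_ `^ _); field.
    have factor (p q x1 x2 x3 x4 x5 x6 x7 x8 x9 : R) :
        p * x1 * x2 * x3 + p * x4 * x5 * x6 * x7 * x8 + p * q * x9
        = p * (x1 * x2 * x3 + x4 * x5 * x6 * x7 * x8 + q * x9) by ring.
    by rewrite /T E2 {1}E1; exact: factor.
  have -> : Num.sqrt e = e `^ (1 / 2) by rewrite div1r powR12_sqrt ?(ltW e0).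
  exact: (ler_wpM2l (powR_ge0 _ _) H2).
have bnd2 r0 : 0 < r0 ->
    exists B, forall r, r0 <= r -> `|derive1n 2 phi r| <= B.
  move=> r00; exists (Csup phi 2 r0) => r.
  exact: (Csup_ge R phi rs 2 _ _ hphi isT r00).
have res u : inU N u ->
    `|avg N (fun xi => stress (derive1n 1 phi) (alpha gamma) (beta gamma)
         (d1 N y) xi * d1 N u xi) - pairing N f u| <= T * U12norm N u.
  move=> uU.
  have st := stationarity R phi (derive1n 1 phi) (derive1n 2 phi) N F f
    (fun=> 0) (fun=> 1) _ y u (fun r => der 0%N r isT) (fun r => der 1%N r isT)
    bnd2 hN (fun _ => erefl) _ hy uU.
  rewrite -st; last by move=> w _; rewrite /Phi_total Phi_pair_energy.
  rewrite (eq_avg _ _ (fun xi => stress _ (alpha gamma) _ _ _ * _)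
    (fun xi => stress (derive1n 1 phi) (fun=> 0) (fun=> 1) (d1 N y) xi * d1 N u xi
      + blend_defect (derive1n 1 phi) gamma (d1 N y) xi * d1 N u xi)); last first.
    by move=> xi; rewrite stress_blend mulrDl.
  rewrite avgD addrC addKr.
  have := blend_defect_l2 R (derive1n 1 phi) (derive1n 2 phi) (derive1n 3 phi)
    N k F gamma y I ymin (C 1%N) (C 2%N) (C 3%N) (d1 N u) (fun r => der 1%N r isT)
    (fun r => der 2%N r isT) hN ym0 yY my (fun r => Cge 1%N r isT)
    (fun r => Cge 2%N r isT) (fun r => Cge 3%N r isT) pg hI.
  move=> /le_trans; apply; rewrite /U12norm ler_wpM2r ?l2_ge0 //.
have kA : Amin / 2 <= kappa0 - 17 * M * eta ymin Amin.
  by rewrite /kappa0; move: etaM; clear; lra.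
have k0 : 0 < kappa0 - 17 * M * eta ymin Amin.
  by apply: lt_le_trans kA; rewrite divr_gt0.
have TkA : 2 * T / (kappa0 - 17 * M * eta ymin Amin) <= 4 / Amin * T.
  rewrite ler_pdivrMr //; apply: le_trans (ler_wpM2l _ kA); last first.
    by rewrite mulr_ge0 // divr_ge0 // ltW.
  by apply: eq_ler; field; rewrite gt_eqF.
have rsy : rs <= 2 * ymin by move: hmin; rewrite -/ymin; clear; lra.
have etaI : 0 < eta ymin Amin <= ymin / 2 by rewrite eta0 etam.
have qceE w : admissible N F w -> Phi_qce_total N phi gamma f w
    = pair_energy N phi (alpha gamma) (beta gamma) (d1 N w) - pairing N f w.
  move=> [wY _]; rewrite /Phi_qce_total Phi_qce_pair_energy //.
  exact: (periodic_d1_inY _ _ _ _ wY).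
have small : 2 * T / (kappa0 - 17 * M * eta ymin Amin) < Num.sqrt e * eta ymin Amin.
  apply: le_lt_trans TkA _.
  rewrite mulrAC ltr_pdivrMr //.
  have : 0 < Num.sqrt e * (eta ymin Amin * Amin) by rewrite !mulr_gt0 // sqrtr_gt0.
  by move: Tsmall; clear; lra.
have [yg yg1 yg2] := nearby_minimizer R phi (derive1n 1 phi) (derive1n 2 phi) N F f
  (alpha gamma) (beta gamma) y (Phi_qce_total N phi gamma f) ymin M
  (eta ymin Amin) kappa0 T (fun r => der 0%N r isT) (fun r => der 1%N r isT) bnd2
  (fun r hr => potential_concave R phi rs r hphi (le_trans rsy hr))
  (fun p q => potential_lipschitz R phi rs (ymin / 2) p q hphi ym20) M0 ym0
  etaI (fun xi => alpha_in01 R N gamma xi hgamma)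
  (fun xi => beta_in01 R N gamma xi hgamma) hN (periodic_beta _ _ _ pg) yY my
  hess qceE T0 res k0 small.
by exists yg => //; exact: le_trans yg2 TkA.
Qed.
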